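(* Let $d\ge 1$ be an integer. The affine span in $\mathbb{R}^{d+1}$ of the set of $\alpha$-vectors $(\alpha_0(\Delta),\alpha_1(\Delta),\ldots,\alpha_d(\Delta))$ of all $d$-simplices $\Delta$ has dimension $\left\lfloor \frac{d-1}{2}\right\rfloor$.
   Context: A $d$-polytope is a $d$-dimensional convex polytope in Euclidean space. For a $d$-polytope $P$ and a nonempty face $F$ of $P$ (including $F=P$), the interior angle $\alpha(F,P)$ is the fraction of a $d$-dimensional ball (in the affine hull of $P$), centered at a relative interior point of $F$ and small enough to meet only those faces of $P$ that contain $F$, which is contained in $P$. Thus $\alpha(F,P)=\frac12$ for facets $F$ and $\alpha(P,P)=1$. The angle sums are $\alpha_i(P)=\sum_{i\text{-faces }F\subseteq P}\alpha(F,P)$ for $0\le i\le d$, and the $\alpha$-vector of $P$ is $(\alpha_0(P),\ldots,\alpha_d(P))$. A $d$-simplex is the convex hull of $d+1$ affinely independent points. *)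

(* Defs.v *)
From HB Require Import structures.
From mathcomp Require Import all_boot all_order all_algebra.
From mathcomp Require Import all_classical all_reals all_analysis.

Set Implicit Arguments.
Unset Strict Implicit.
Unset Printing Implicit Defensive.

Import Order.TTheory GRing.Theory Num.Theory.

Local Open Scope classical_set_scope.
Local Open Scope ring_scope.

Section ProductStep.
Context {R : realType} (d : nat).
Variable m : {sigma_finite_measure set (d.-tuple (measurableTypeR R)) -> \bar R}.

Let cons_pair (z : measurableTypeR R * d.-tuple (measurableTypeR R)) :
  d.+1.-tuple (measurableTypeR R) := [tuple of z.1 :: z.2].

Let uncons_pair (t : d.+1.-tuple (measurableTypeR R)) :
  measurableTypeR R * d.-tuple (measurableTypeR R) :=
  (tnth t ord0, [tuple of behead t]).

(** The product of the one-dimensional Lebesgue measure with [m], carried over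
    from pairs to tuples. *)
Definition cons_measure : set (d.+1.-tuple (measurableTypeR R)) -> \bar R :=
  pushforward (lebesgue_measure \x m)%E cons_pair.

Let measurable_cons_pair : measurable_fun setT cons_pair.
Proof. by apply: measurable_cons. Qed.

Let measurable_uncons_pair : measurable_fun setT uncons_pair.
Proof.
apply/measurable_fun_pairP; split; first exact: measurable_tnth.
exact: measurable_behead.
Qed.

HB.instance Definition _ := Measure.copy cons_measure
  (measure_function_pushforward__canonical__measure_function_Measure
    (lebesgue_measure \x m)%E measurable_cons_pair).

Let cons_measure_sigma_finite : sigma_finite setT cons_measure.
Proof.
have /sigma_finiteP[F [TF ndF Foo]] :=
  sigma_finiteT (@lebesgue_measure R : {sigma_finite_measure set _ -> \bar R}).
have /sigma_finiteP[G [TG ndG Goo]] := sigma_finiteT m.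
exists (fun k => uncons_pair @^-1` (F k `*` G k)).
  apply/esym; rewrite -subTset => t _.
  have [i _ Fi] : (\bigcup_i F i) (uncons_pair t).1 by rewrite -TF.
  have [j _ Gj] : (\bigcup_i G i) (uncons_pair t).2 by rewrite -TG.
  exists (maxn i j) => //; split.
    by move: Fi; exact/subsetPset/ndF/leq_maxl.
  by move: Gj; exact/subsetPset/ndG/leq_maxr.
move=> k; have [mFk Fk] := Foo k; have [mGk Gk] := Goo k; split.
  rewrite -[X in measurable X]setTI; apply: measurable_uncons_pair => //.
  exact: measurableX.
rewrite /cons_measure /pushforward -comp_preimage (_ : _ \o _ = id); last first.
  by apply/funext => -[x t]; congr pair; apply: val_inj.
by rewrite preimage_id product_measure1E// lte_mul_pinfty// ge0_fin_numE.
Qed.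

HB.instance Definition _ := Measure_isSigmaFinite.Build _ _ _ cons_measure
  cons_measure_sigma_finite.

End ProductStep.

(** d-dimensional Lebesgue measure on the Borel sets of R^d; [vol_box] checks
    the normalization. *)
Fixpoint vol {R : realType} (d : nat) :
    {sigma_finite_measure set (d.-tuple (measurableTypeR R)) -> \bar R} :=
  match d with
  | 0 => \d_([tuple])
  | d'.+1 => cons_measure (vol d')
  end.

Lemma vol_box (R : realType) (d : nat) (a b : d.-tuple R) :
  (forall i, tnth a i <= tnth b i) ->
  vol d [set t : d.-tuple R | forall i, tnth a i <= tnth t i <= tnth b i]
  = (\prod_(i < d) (tnth b i - tnth a i))%:E.
Proof.
elim: d a b => [|d IH] a b ab.
  by rewrite big_ord0 /= diracE mem_set// => -[].
have sd (t : d.+1.-tuple R) i : tnth [tuple of behead t] i = tnth t (lift ord0 i).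
  by case/tupleP: t => x t; rewrite tnthS; congr (tnth _ i); apply: val_inj.
rewrite big_ord_recl /= /cons_measure /pushforward.
set A := _ @^-1` _.
pose A' := [set t : d.-tuple R | forall i,
  tnth [tuple of behead a] i <= tnth t i <= tnth [tuple of behead b] i].
have -> : A = `[tnth a ord0, tnth b ord0]%classic `*` A'.
  apply/seteqP; split => [[x t] h|[x t] [/= h0 h] i].
    split; first by have := h ord0; rewrite /= in_itv.
    by move=> i; have := h (lift ord0 i); rewrite /= !sd tnthS.
  have [j ->|->] := unliftP ord0 i; last by move: h0; rewrite in_itv.
  by have := h j; rewrite !sd /= tnthS.
have mA' : measurable (A' : set (d.-tuple (measurableTypeR R))).
  have -> : A' = \bigcap_(i : 'I_d) ((fun t : d.-tuple (measurableTypeR R) =>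
      tnth t i) @^-1` `[tnth [tuple of behead a] i, tnth [tuple of behead b] i]).
    apply/seteqP; split => [t h i _|t h i]; first by rewrite /= in_itv; exact: h.
    by have := h i I; rewrite /= in_itv.
  apply: fin_bigcap_measurable => // i _; rewrite -[X in measurable X]setTI.
  by apply: measurable_tnth.
rewrite product_measure1E//= lebesgue_measure_itv/= lte_fin IH; last first.
  by move=> i; rewrite !sd.
rewrite -[X in _ = X]/(_%:E) EFinM; congr (_ * _)%E.
  by case: ltgtP (ab ord0) => // ->; rewrite subrr.
by congr (_%:E); apply: eq_bigr => i _; rewrite !sd.
Qed.

Section Polytopes.
Context {R : realType} {n : nat}.
Implicit Types (S P F : set 'rV[R]_n) (x : 'rV[R]_n).

Definition dot (u v : 'rV[R]_n) : R := (u *m v^T) ord0 ord0.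

(** The norm that MathComp-Analysis puts on ['rV_n] is the sup norm, so the
    Euclidean balls are spelled out. *)
Definition eball x (r : R) : set 'rV[R]_n :=
  [set y | Num.sqrt (dot (y - x) (y - x)) <= r].

Definition aff_hull S : set 'rV[R]_n :=
  [set x | exists k (w : 'I_k -> R) (p : 'I_k -> 'rV[R]_n),
     [/\ forall i, S (p i), \sum_i w i = 1 & x = \sum_i w i *: p i]].

Definition conv_hull S : set 'rV[R]_n :=
  [set x | exists k (w : 'I_k -> R) (p : 'I_k -> 'rV[R]_n),
     [/\ forall i, S (p i), forall i, 0 <= w i, \sum_i w i = 1
       & x = \sum_i w i *: p i]].

Definition aff_indep (k : nat) (v : 'I_k -> 'rV[R]_n) : Prop :=
  forall w : 'I_k -> R, \sum_i w i = 0 -> \sum_i w i *: v i = 0 ->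
  forall i, w i = 0.

Definition flat (k : nat) x (B : 'M[R]_(k, n)) : set 'rV[R]_n :=
  [set x + u *m B | u in setT].

Definition aff_dim S (k : nat) : Prop :=
  exists x (B : 'M[R]_(k, n)), row_free B /\ aff_hull S = flat x B.

Definition is_simplex (d : nat) P : Prop :=
  exists2 v : 'I_d.+1 -> 'rV[R]_n, aff_indep v & P = conv_hull (range v).

(** Nonempty faces; [c = 0] and [b = 0] give [P] itself. *)
Definition is_face F P : Prop :=
  F !=set0 /\ exists (c : 'rV[R]_n) (b : R),
    (forall x, P x -> dot c x <= b) /\ F = P `&` [set x | dot c x = b].

Definition relint F : set 'rV[R]_n :=
  [set x | F x /\ exists2 r : R, 0 < r & eball x r `&` aff_hull F `<=` F].

(** Orthonormal coordinates on the affine hull of [P]: an origin [z.1] and an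
    orthonormal basis, the rows of [z.2], of the direction space. *)
Definition is_frame (d : nat) P (z : 'rV[R]_n * 'M[R]_(d, n)) : Prop :=
  z.2 *m z.2^T = 1%:M /\ aff_hull P = flat z.1 z.2.

Definition frame (d : nat) P : 'rV[R]_n * 'M[R]_(d, n) :=
  xget (0, 0) (is_frame (d := d) P).

(** The d-dimensional volume of the part of [S] inside the d-dimensional affine
    hull of [P].  Two frames differ by an isometry of R^d, which preserves
    [vol], so the choice made by [frame] is immaterial. *)
Definition relvol (d : nat) P S : \bar R :=
  let: (x, B) := frame d P in
  vol d [set t : d.-tuple R | S (x + (\row_i tnth t i) *m B)].

(** All admissible centers [x] and radii [r] give the same fraction [a]. *)
Definition is_int_angle (d : nat) F P (a : R) : Prop :=
  exists x (r : R),
    [/\ relint F x, 0 < r,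
        forall G, is_face G P -> eball x r `&` G !=set0 -> F `<=` G
      & a = fine (relvol d P (eball x r `&` P)) /
            fine (relvol d P (eball x r))].

Definition int_angle (d : nat) F P : R := xget 0 (is_int_angle d F P).

Definition angle_sum (d : nat) P (i : nat) : R :=
  \sum_(F \in [set F | is_face F P /\ aff_dim F i]) int_angle d F P.

Definition alpha_vector (d : nat) P : 'rV[R]_d.+1 :=
  \row_(i < d.+1) angle_sum d P i.

End Polytopes.

Definition simplex_alpha_vectors (R : realType) (d : nat) : set 'rV[R]_d.+1 :=
  [set a | exists n (P : set 'rV[R]_n),
     is_simplex d P /\ a = alpha_vector d P].
Arguments simplex_alpha_vectors R d : clear implicits.

(* Main.v *)
Require Import Defs.
From mathcomp Require Import all_boot all_order all_algebra.
From mathcomp Require Import all_classical all_reals all_analysis.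
From mathcomp Require Import measurable_realfun measurable_fun_approximation.
From mathcomp Require Import ring lra zify.

(** For a direction u in the span of a d-simplex, let N(u) be the set of indices
    of the barycentric coordinates that decrease along u.  The angle at the face
    with vertex set S is the probability that N(u) is contained in S, so
    alpha_i is the sum over T of P(N = T) * C(d + 1 - #|T|, d - i).  Reversing u
    gives P(N = T) = P(N = ~: T), and N is almost surely neither empty nor full;
    hence the alpha-vector is an affine combination of floor((d + 1) / 2) fixed
    vectors, one for each pair {t, d + 1 - t}, and these vectors are linearly
    independent because they form a triangular matrix.  Conversely, stretching a
    simplex orthogonally to a direction along which exactly k barycentric
    coordinates decrease concentrates the law of #|N| near {k, d + 1 - k}.  The
    matrix of weights of these simplices is diagonally dominant, so their
    alpha-vectors already span. *)

Set Implicit Arguments.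
Unset Strict Implicit.
Unset Printing Implicit Defensive.

Import Order.TTheory GRing.Theory Num.Theory.

Local Open Scope classical_set_scope.
Local Open Scope ring_scope.

(** * Homotheties and Lebesgue measure *)

(** Both sides are measures in [A], so by uniqueness of Lebesgue measure it is enough to compare
    them on the intervals []a, b]]. *)
Lemma lebesgue_measure_affine (R : realType) (x r : R) (A : set (measurableTypeR R)) :
  r != 0 -> measurable A ->
  (lebesgue_measure A = `|r|%:E * lebesgue_measure ((fun a => (x + r * a)%R) @^-1` A))%E.
Proof.
move=> r0 mA.
have mf : measurable_fun setT ((fun a => x + r * a) : measurableTypeR R -> measurableTypeR R).
  apply: measurable_funD; first exact: measurable_cst.
  by apply: measurable_funM => //; exact: measurable_cst.
pose m0 := measure_function_pushforward__canonical__measure_function_Measure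
  (@lebesgue_measure R) mf.
have r_ge0 : 0 <= `|r| by [].
pose m' := mscale (NngNum r_ge0) m0.
rewrite (lebesgue_measure_unique (mu := m')) // => _ [[a b]] _ <-.
transitivity (`|r|%:E *
    lebesgue_measure ((fun y : R => (x + r * y)%R) @^-1` [set` `]a, b]]))%E; last by [].
rewrite /= lebesgue_measure_itv /=.
case: (ltgtP r 0) (r0) => // rs _.
(* A negative ratio reverses the interval and moves the closed end to the left. *)
- rewrite (_ : _ @^-1` _ = `[(b - x) / r, (a - x) / r[%classic); last first.
    apply/seteqP; split => y /=; rewrite !in_itv /=;
      rewrite ler_ndivrMr // ltr_ndivlMr // => /andP[];
      rewrite (mulrC y r); lra.
  rewrite lebesgue_measure_itv /= !lte_fin ltr_nM2r ?invr_lt0 // ltrD2r.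
  case: ifP => _; last by rewrite mule0.
  by rewrite -!EFinD -EFinM ltr0_norm //; congr (_%:E); field.
- rewrite (_ : _ @^-1` _ = `](a - x) / r, (b - x) / r]%classic); last first.
    apply/seteqP; split => y /=; rewrite !in_itv /=;
      rewrite ler_pdivlMr // ltr_pdivrMr // => /andP[];
      rewrite (mulrC y r); lra.
  rewrite lebesgue_measure_itv /= !lte_fin ltr_pM2r ?invr_gt0 // ltrD2r.
  case: ifP => _; last by rewrite mule0.
  by rewrite -!EFinD -EFinM gtr0_norm //; congr (_%:E); field.
Qed.

Lemma tnth_behead_lift (T : Type) d (t : d.+1.-tuple T) (i : 'I_d) :
  tnth [tuple of behead t] i = tnth t (lift ord0 i).
Proof.
by case/tupleP: t => a t; rewrite tnthS; congr (tnth _ _); apply: val_inj.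
Qed.

Definition homothety (R : realType) d (x : d.-tuple R) (r : R) (t : d.-tuple R) :
  d.-tuple R := [tuple tnth x i + r * tnth t i | i < d].

Lemma measurable_homothety (R : realType) d (x : d.-tuple R) (r : R) :
  measurable_fun setT (homothety x r :
    d.-tuple (measurableTypeR R) -> d.-tuple (measurableTypeR R)).
Proof.
apply/measurable_fun_tnthP => i.
rewrite (_ : _ \o _ = (fun t => tnth x i + r * tnth t i)); last first.
  by apply/funext => t /=; rewrite tnth_mktuple.
apply: measurable_funD; first exact: measurable_cst.
by apply: measurable_funM; [exact: measurable_cst | exact: measurable_tnth].
Qed.

(** Induction on the dimension: on pairs the homothety acts factorwise, so the rescaled image
    measure agrees with the product measure on rectangles, hence everywhere. Ratio -1 gives
    invariance under point reflection. *)
Lemma vol_homothety (R : realType) d (x : d.-tuple R) (r : R)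
    (A : set (d.-tuple (measurableTypeR R))) :
  r != 0 -> measurable A ->
  (vol d A = (`|r| ^+ d)%:E * vol d (homothety x r @^-1` A))%E.
Proof.
move=> r0; elim: d x A => [|d IH] x A mA.
  rewrite expr0 mul1e (_ : homothety x r @^-1` A = A) //.
  by apply/seteqP; split => t; rewrite /= [t]tuple0 [homothety _ _ _]tuple0.
rewrite /= /cons_measure /pushforward.
set c := fun z : measurableTypeR R * _ => _.
pose g (z : measurableTypeR R * d.-tuple (measurableTypeR R)) :
    measurableTypeR R * d.-tuple (measurableTypeR R) :=
  (tnth x ord0 + r * z.1, homothety [tuple of behead x] r z.2).
have cg z : homothety x r (c z) = c (g z).
  case: z => a t; apply: eq_from_tnth => i; rewrite tnth_mktuple.
  have [j ->|->] := unliftP ord0 i; last by rewrite !tnth0.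
  by rewrite /c /= !tnthS tnth_mktuple tnth_behead_lift.
have -> : c @^-1` (homothety x r @^-1` A) = g @^-1` (c @^-1` A).
  by apply/funext => z; rewrite /preimage /= cg.
have mc : measurable_fun setT c by apply: measurable_cons.
have mg : measurable_fun setT g.
  apply/measurable_fun_pairP; split.
    apply: measurable_funD; first exact: measurable_cst.
    by apply: measurable_funM => //; exact: measurable_cst.
  exact: (measurableT_comp (measurable_homothety _ _)).
pose m0 := measure_function_pushforward__canonical__measure_function_Measure
  (product_measure1 lebesgue_measure (vol d)) mg.
have r_ge0 : 0 <= `|r| ^+ d.+1 by rewrite exprn_ge0.
pose m' := mscale (NngNum r_ge0) m0.
have mcA : measurable (c @^-1` A).
  by rewrite -[X in measurable X]setTI; exact: mc.
rewrite (product_measure_unique (m' := m')) // => A1 B1 mA1 mB1.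
have mpre d0 (T : measurableType d0) (f : T -> T) B : measurable_fun setT f -> measurable B ->
    measurable (f @^-1` B) by move=> mf mB; rewrite -[X in measurable X]setTI; exact: mf.
transitivity ((`|r| ^+ d.+1)%:E *
    (lebesgue_measure \x vol d) (((fun a => (tnth x ord0 + r * a)%R) @^-1` A1) `*`
      (homothety [tuple of behead x] r @^-1` B1)))%E; first by [].
rewrite product_measure1E //; last 2 first.
- apply: mpre => //; apply: measurable_funD; first exact: measurable_cst.
  by apply: measurable_funM => //; exact: measurable_cst.
- by apply: mpre => //; exact: measurable_homothety.
apply: esym; apply: etrans.
  exact: (f_equal2 mule (lebesgue_measure_affine (tnth x ord0) r0 mA1)
                        (IH [tuple of behead x] _ mB1)).
by rewrite exprS EFinM -!muleA; congr (_ * _)%E; rewrite muleCA.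
Qed.

(** * Hyperplanes, balls and boxes *)

Definition linform (R : realType) d (a : 'I_d -> R) (t : d.-tuple R) : R :=
  \sum_i tnth t i * a i.

Lemma measurable_linform (R : realType) d (a : 'I_d -> R) :
  measurable_fun setT (linform a : d.-tuple (measurableTypeR R) -> measurableTypeR R).
Proof.
apply: measurable_sum => i.
by apply: measurable_funM; [exact: measurable_tnth | exact: measurable_cst].
Qed.

Lemma measurable_linform_ge0 (R : realType) d (a : 'I_d -> R) :
  measurable ([set t | 0 <= linform a t] : set (d.-tuple (measurableTypeR R))).
Proof.
rewrite (_ : [set _ | _] = setT `&` linform a @^-1` `[0, +oo[%classic); last first.
  by rewrite setTI; apply/seteqP; split => t /=; rewrite in_itv /= andbT.
by apply: measurable_linform => //; exact: measurable_itv.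
Qed.

Lemma measurable_linform_lt0 (R : realType) d (a : 'I_d -> R) :
  measurable ([set t | linform a t < 0] : set (d.-tuple (measurableTypeR R))).
Proof.
rewrite (_ : [set _ | _] = setT `&` linform a @^-1` `]-oo, 0[%classic); last first.
  by rewrite setTI; apply/seteqP; split => t /=; rewrite in_itv.
by apply: measurable_linform => //; exact: measurable_itv.
Qed.

Definition hyperplane (R : realType) d (a : 'I_d -> R) (b : R) :
  set (d.-tuple (measurableTypeR R)) := [set t | linform a t = b].

Lemma measurable_hyperplane (R : realType) d (a : 'I_d -> R) (b : R) :
  measurable (hyperplane a b).
Proof.
rewrite (_ : hyperplane a b = setT `&` linform a @^-1` [set b]); last first.
  by rewrite setTI.
by apply: measurable_linform => //; exact: measurable_set1.
Qed.

(** By Fubini: if a later coefficient is nonzero, each section at a fixed first coordinate is a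
    hyperplane in one dimension less; otherwise the set is a point times the whole space. *)
Lemma vol_hyperplane (R : realType) d (a : 'I_d -> R) (b : R) (i : 'I_d) :
  a i != 0 -> vol d (hyperplane a b) = 0%E.
Proof.
elim: d a b i => [a b []//|d IH] a b i ai0.
rewrite /= /cons_measure /pushforward.
set c := fun z : measurableTypeR R * _ => _.
have lfc x t : linform a (c (x, t)) = x * a ord0 + linform (a \o lift ord0) t.
  rewrite /linform big_ord_recl tnth0; congr (_ + _); apply: eq_bigr => j _.
  by rewrite tnthS.
have [[j aj0]|a0] := pselect (exists j, a (lift ord0 j) != 0).
  rewrite /product_measure1; apply: integral0_eq => x _ /=.
  rewrite (_ : xsection _ x = hyperplane (a \o lift ord0) (b - x * a ord0)).
    exact: (IH _ _ j).
  apply/seteqP; split => t; rewrite /xsection /hyperplane /= inE /= lfc => h.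
    by rewrite -h addrC addKr.
  by rewrite h addrC subrK.
have {}a0 j : a (lift ord0 j) = 0 by apply/eqP/negPn/negP => h; apply: a0; exists j.
have ao0 : a ord0 != 0.
  by have [j ij|<-//] := unliftP ord0 i; move: ai0; rewrite ij a0 eqxx.
rewrite (_ : c @^-1` _ = [set b / a ord0] `*` setT); last first.
  apply/seteqP; split => -[x t]; rewrite /hyperplane /= lfc.
    by rewrite [linform _ _]big1 ?addr0 => [<-|k _]; [rewrite mulfK | rewrite /= a0 mulr0].
  case=> -> _; rewrite [linform _ _]big1 ?addr0 => [|k _]; last by rewrite /= a0 mulr0.
  by rewrite divfK.
rewrite product_measure1E //.
by rewrite (_ : _ [set b / a ord0] = 0%E) ?mul0e //; exact: lebesgue_measure_set1.
Qed.

Definition cball (R : realType) d (r : R) : set (d.-tuple (measurableTypeR R)) :=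
  [set t | \sum_i tnth t i ^+ 2 <= r ^+ 2].

Lemma measurable_cball (R : realType) d (r : R) : measurable (@cball R d r).
Proof.
pose f (t : d.-tuple (measurableTypeR R)) : measurableTypeR R := \sum_i tnth t i ^+ 2.
rewrite (_ : cball r = setT `&` f @^-1` `]-oo, r ^+ 2]%classic); last first.
  by rewrite setTI; apply/seteqP; split => t /=; rewrite /f in_itv.
have mf : measurable_fun setT f.
  by apply: measurable_sum => i; apply: measurable_funX; exact: measurable_tnth.
by apply: mf => //; exact: measurable_itv.
Qed.

Lemma cball_le (R : realType) d (r : R) (t : d.-tuple R) i :
  0 <= r -> cball r t -> `|tnth t i| <= r.
Proof.
move=> r0 h; rewrite -(@ler_pXn2r _ 2) ?nnegrE // real_normK ?num_real //.
apply: le_trans h; rewrite (bigD1 i) //= lerDl sumr_ge0 // => j _.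
exact: sqr_ge0.
Qed.

Definition box (R : realType) d (s : 'I_d -> R) : set (d.-tuple (measurableTypeR R)) :=
  [set t | forall i, `|tnth t i| <= s i].

Lemma measurable_box (R : realType) d (s : 'I_d -> R) : measurable (box s).
Proof.
rewrite (_ : box s = \bigcap_(i : 'I_d)
    (setT `&` (fun t : d.-tuple (measurableTypeR R) => tnth t i) @^-1` `[- s i, s i])).
  apply: fin_bigcap_measurable => // i _.
  by apply: measurable_tnth => //; exact: measurable_itv.
apply/seteqP; split => t.
  by move=> h i _; split => //=; rewrite in_itv /= -ler_norml.
by move=> h i; have [_] := h i I; rewrite /= in_itv /= -ler_norml.
Qed.

Lemma vol_centered_box (R : realType) d (s : 'I_d -> R) :
  (forall i, 0 <= s i) -> vol d (box s) = (\prod_(i < d) (2 * s i))%:E.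
Proof.
move=> s0; pose a := [tuple - s i | i < d]; pose b := [tuple s i | i < d].
rewrite (_ : box s = [set t : d.-tuple R |
    forall i, tnth a i <= tnth t i <= tnth b i]); last first.
  apply/seteqP; split => t h i; have := h i; rewrite !tnth_mktuple;
    by rewrite ler_norml.
rewrite vol_box => [|i]; last by rewrite !tnth_mktuple ge0_cp.
congr (_%:E); apply: eq_bigr => i _; rewrite !tnth_mktuple; ring.
Qed.

Lemma vol_cball_lty (R : realType) d (r : R) : 0 <= r -> (vol d (@cball R d r) < +oo)%E.
Proof.
move=> r0; apply: (@le_lt_trans _ _ (vol d (box (fun=> r)))).
  apply: le_measure; rewrite ?inE; [exact: measurable_cball|exact: measurable_box|].
  by move=> t h i; exact: cball_le.
by rewrite vol_centered_box // ltry.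
Qed.

Lemma vol_cball_gt0 (R : realType) d (r : R) : 0 < r -> (0 < vol d (@cball R d r))%E.
Proof.
move=> r0; pose s := r / d.+1%:R.
have s0 : 0 < s by rewrite divr_gt0.
apply: (@lt_le_trans _ _ (vol d (box (fun=> s)))).
  rewrite vol_centered_box => [|_]; last exact: ltW.
  by rewrite lte_fin prodr_gt0 // => _ _; rewrite mulr_gt0.
apply: le_measure; rewrite ?inE; [exact: measurable_box|exact: measurable_cball|].
move=> t h; rewrite /cball /=.
have : \sum_i tnth t i ^+ 2 <= \sum_(i < d) s ^+ 2.
  apply: ler_sum => i _; rewrite -real_normK ?num_real //.
  by rewrite ler_pXn2r ?nnegrE // ?ltW.
move/le_trans; apply; rewrite sumr_const card_ord /s expr_div_n -[_ *+ d]mulr_natr.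
rewrite -mulrA ler_piMr ?sqr_ge0 // mulrC ler_pdivrMr ?exprn_gt0 // mul1r.
by rewrite -natrX ler_nat; nia.
Qed.

Lemma measurable_slab (R : realType) d (e : R) :
  measurable ([set t | `|tnth t ord0| <= e] `&` @cball R d.+1 1).
Proof.
apply: measurableI; last exact: measurable_cball.
pose f (t : d.+1.-tuple (measurableTypeR R)) : measurableTypeR R := tnth t ord0.
rewrite (_ : [set _ | _] = setT `&` f @^-1` `[- e, e]).
  by apply: measurable_tnth => //; exact: measurable_itv.
by rewrite setTI; apply/seteqP; split => t /=; rewrite /f in_itv /= ler_norml.
Qed.

Lemma vol_slab_le (R : realType) d (e : R) : 0 <= e ->
  (vol d.+1 ([set t | (`|tnth t ord0| <= e)%R] `&` @cball R d.+1 1) <= (2 ^+ d.+1 * e)%R%:E)%E.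
Proof.
move=> e0; pose s (i : 'I_d.+1) := if i == ord0 then e else 1.
have s0 i : 0 <= s i by rewrite /s; case: ifP.
have -> : 2 ^+ d.+1 * e = \prod_(i < d.+1) (2 * s i).
  rewrite big_ord_recl {1}/s eqxx exprS.
  rewrite (eq_bigr (fun=> 2)) => [|i _]; last by rewrite /s /= mulr1.
  by rewrite prodr_const card_ord; ring.
rewrite -vol_centered_box //; apply: le_measure; rewrite ?inE.
- exact: measurable_slab.
- exact: measurable_box.
- by move=> t [h1 h2] i; rewrite /s; case: eqP => [->//|_]; exact: cball_le.
Qed.

(** * Affine spans *)

(** At an index [i] maximizing [|v i 0|], row [i] of [W *m v = 0] gives
    [W i i * |v i 0| <= (1 - W i i) * |v i 0|], and a weight above one half forces [v i 0 = 0]. *)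
Lemma dominant_diag_unitmx (R : realFieldType) m (W : 'M[R]_m.+1) :
  (forall i j, 0 <= W i j) -> (forall i, \sum_j W i j = 1) ->
  (forall i, 1 < 2 * W i i) -> W \in unitmx.
Proof.
move=> W0 W1 Wd; rewrite -unitmx_tr -row_free_unit.
suff Wker (v : 'cV_m.+1) : W *m v = 0 -> v = 0.
  apply: inj_row_free => v /(congr1 trmx); rewrite trmx_mul trmxK trmx0.
  by move/Wker/(congr1 trmx); rewrite trmxK trmx0.
move=> Wv0.
have [i _ imax] := @arg_maxP _ _ 'I_m.+1 ord0 xpredT (fun i => `|v i 0|) isT.
suff vi0 : `|v i 0| <= 0.
  apply/matrixP => j k; rewrite ord1 mxE; apply/eqP; rewrite -normr_le0.
  exact: le_trans (imax j isT) vi0.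
have /eqP : (W *m v) i 0 = 0 by rewrite Wv0 mxE.
rewrite mxE (bigD1 i) //= addr_eq0 => /eqP /(congr1 Num.norm).
rewrite normrN normrM (ger0_norm (W0 _ _)) => E.
have : W i i * `|v i 0| <= (1 - W i i) * `|v i 0|.
  have -> : 1 - W i i = \sum_(j | j != i) W i j.
    by have := W1 i; rewrite (bigD1 i) //= => <-; rewrite addrAC subrr add0r.
  rewrite E mulr_suml; apply: le_trans (ler_norm_sum _ _ _) _.
  apply: ler_sum => j _; rewrite normrM (ger0_norm (W0 _ _)).
  by apply: ler_wpM2l => //; exact: imax.
have := Wd i; have := normr_ge0 (v i 0); nra.
Qed.

Definition aff_combs (R : realType) k n (B : 'M[R]_(k, n)) : set 'rV[R]_n :=
  [set s *m B | s in [set s : 'rV[R]_k | \sum_i s 0 i = 1]].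

Section DifferenceMatrix.
Context {R : realType} {m : nat}.

(** The rows [e_(i+1) - e_0] form a basis of the vectors with entry sum 0; they turn weights of sum
    1 into free parameters. *)
Definition diff_mx : 'M[R]_(m, m.+1) :=
  \matrix_(i, k) ((k == lift ord0 i)%:R - (k == ord0)%:R).

Lemma mul_diff_mx (u : 'rV[R]_m) i : (u *m diff_mx) 0 (lift ord0 i) = u 0 i.
Proof.
rewrite mxE (bigD1 i) //= big1 => [|j ji].
  by rewrite mxE eqxx -(inj_eq val_inj) /= subr0 mulr1 addr0.
by rewrite mxE (inj_eq lift_inj) eq_sym (negbTE ji) -(inj_eq val_inj) /= subrr mulr0.
Qed.

Lemma mul_diff_mx0 (u : 'rV[R]_m) : (u *m diff_mx) 0 ord0 = - \sum_i u 0 i.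
Proof.
rewrite mxE -sumrN; apply: eq_bigr => i _.
by rewrite mxE eqxx -(inj_eq val_inj) /= sub0r mulrN1.
Qed.

Lemma row_free_diff_mx : row_free diff_mx.
Proof.
apply: inj_row_free => u u0; apply/rowP => i.
by rewrite -mul_diff_mx u0 !mxE.
Qed.

Lemma aff_combs_flat n (B : 'M[R]_(m.+1, n)) :
  aff_combs B = flat (row ord0 B) (diff_mx *m B).
Proof.
apply/seteqP; split => [_ [s /= s1 <-]|_ [u _ <-]].
  exists (\row_i s 0 (lift ord0 i)) => //.
  rewrite rowE mulmxA -mulmxDl; congr (_ *m _); apply/rowP => k.
  rewrite mxE [delta_mx _ _ _ _]mxE eqxx /=; have [j ->|->] := unliftP ord0 k.
    by rewrite mul_diff_mx mxE -(inj_eq val_inj) /= add0r.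
  rewrite mul_diff_mx0 eqxx -s1 big_ord_recl /=.
  by under [X in - X]eq_bigr do rewrite mxE; rewrite addrK.
exists (delta_mx 0 ord0 + u *m diff_mx); last by rewrite rowE mulmxDl mulmxA.
rewrite /= big_ord_recl mxE mul_diff_mx0 mxE !eqxx /=.
rewrite [X in _ + X](eq_bigr (fun i => u 0 i)) ?subrK // => i _.
by rewrite mxE mul_diff_mx mxE /= add0r.
Qed.

Lemma row_free_mul k n p (A : 'M[R]_(k, n)) (B : 'M[R]_(n, p)) :
  row_free A -> row_free B -> row_free (A *m B).
Proof.
move=> Afree Bfree; apply: inj_row_free => u.
rewrite mulmxA -[RHS](mul0mx _ B) => /(row_free_inj Bfree).
by rewrite -[RHS](mul0mx _ A) => /(row_free_inj Afree).
Qed.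

End DifferenceMatrix.

Lemma sum_affine_combination (R : realType) n k p (B : 'M[R]_(p, n)) (w : 'I_k -> R)
    (s : 'I_k -> 'rV[R]_p) :
  \sum_i w i *: (s i *m B) = (\sum_i w i *: s i) *m B.
Proof. by rewrite mulmx_suml; apply: eq_bigr => i _; rewrite scalemxAl. Qed.

Lemma sum_entries_combination (R : realType) k p (w : 'I_k -> R) (s : 'I_k -> 'rV[R]_p) :
  (forall i, \sum_j s i 0 j = 1) -> \sum_i w i = 1 ->
  \sum_j (\sum_i w i *: s i) 0 j = 1.
Proof.
move=> s1 w1; rewrite -w1.
under eq_bigr do rewrite summxE.
rewrite exchange_big /=; apply: eq_bigr => i _.
by under eq_bigr do rewrite mxE; rewrite -mulr_sumr s1 mulr1.
Qed.

Lemma aff_hull_sub_aff_combs (R : realType) n k (B : 'M[R]_(k, n)) (S : set 'rV[R]_n) :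
  S `<=` aff_combs B -> aff_hull S `<=` aff_combs B.
Proof.
move=> SB x [m [w [p [Sp w1 ->]]]].
have /choice[s sP] i : exists s : 'rV[R]_k, \sum_j s 0 j = 1 /\ s *m B = p i.
  by have [s /= ? ?] := SB _ (Sp i); exists s.
exists (\sum_i w i *: s i) => /=.
  by apply: sum_entries_combination => // i; have [] := sP i.
by rewrite -sum_affine_combination; apply: eq_bigr => i _; have [_ ->] := sP i.
Qed.

(** The rows of [B] bound the affine hull from above. The points with weights [row k W] reach all of
    it, since any weights [s] are the combination of these rows with coefficients [s *m invmx W]. *)
Lemma aff_dim_of_spanning (R : realType) n m (S : set 'rV[R]_n)
    (B : 'M[R]_(m.+1, n)) (W : 'M[R]_m.+1) :
  row_free B -> S `<=` aff_combs B ->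
  W \in unitmx -> (forall k, \sum_j W k j = 1) ->
  (forall k, S (row k W *m B)) -> aff_dim S m.
Proof.
move=> Bfree SB Wu W1 SW; exists (row ord0 B), (diff_mx *m B); split.
  by apply: row_free_mul => //; exact: row_free_diff_mx.
rewrite -aff_combs_flat; apply/seteqP; split => [|x]; first exact: aff_hull_sub_aff_combs.
move=> [s /= s1 <-]; pose c := s *m invmx W.
exists m.+1, (fun i => c 0 i), (fun i => row i W *m B); split => //.
  (* Rows of sum 1 mean that [W] fixes the all-ones column; its inverse does too, so the entries of
     [c] sum to 1. *)
  have W1' : W *m const_mx 1 = const_mx 1 :> 'cV_m.+1.
    apply/colP => i; rewrite !mxE -[RHS](W1 i); apply: eq_bigr => j _.
    by rewrite mxE mulr1.
  have : c *m const_mx 1 = s *m const_mx 1 :> 'cV_1.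
    by rewrite -mulmxA -[in LHS]W1' mulKmx.
  move/matrixP/(_ 0 0); rewrite !mxE.
  under eq_bigr do rewrite [const_mx _ _ _]mxE mulr1.
  by under [in RHS]eq_bigr do rewrite [const_mx _ _ _]mxE mulr1; rewrite s1.
by rewrite sum_affine_combination -mulmx_sum_row mulmxKV.
Qed.

(** * Angle sums and sign patterns *)

(** Complementation turns the supersets of [A] of size [k] into the subsets of [~: A] of size
    [#|T| - k]. *)
Lemma card_supersets (T : finType) (A : {set T}) k : (k <= #|T|)%N ->
  #|[set S : {set T} | (A \subset S) && (#|S| == k)]%SET| = 'C(#|T| - #|A|, #|T| - k).
Proof.
move=> kT; rewrite -(cardsC A) addKn -cards_draws cardsC.
rewrite -(card_imset _ (@finset.setC_inj T)); apply: eq_card => S.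
rewrite inE; apply/imsetP/idP => [[S' + ->]|/andP[SA /eqP Sk]].
  rewrite inE => /andP[AS /eqP Sk]; rewrite finset.setCS AS /=.
  by rewrite cardsCs finset.setCK Sk.
exists (~: S); last by rewrite finset.setCK.
rewrite inE -finset.setCS finset.setCK SA /=.
by rewrite cardsCs finset.setCK Sk subKn.
Qed.

Section AngleSums.
Context {R : realType}.
Variable d : nat.
Hypothesis d_gt0 : (0 < d)%N.

Let m := ((d - 1) %/ 2)%N.

Definition orbit_size (T : {set 'I_d.+1}) := minn #|T| (d.+1 - #|T|).

Lemma orbit_sizeC T : orbit_size (~: T) = orbit_size T.
Proof.
rewrite /orbit_size [#|~: T|]cardsCs finset.setCK card_ord minnC subKn //.
by have := max_card (mem T); rewrite card_ord.
Qed.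

(* [|T|] and [d + 1 - |T|] contribute equally; averaging their contributions
   leaves one row for each pair {t, d + 1 - t}. *)
Definition angle_basis : 'M[R]_(((d - 1) %/ 2).+1, d.+1) :=
  \matrix_(k, i) (2^-1 * ('C(d.+1 - k.+1, d - i) + 'C(k.+1, d - i))%:R).

(** The block of the first [m.+1] columns is triangular, and its diagonal is positive because
    ['C(d - k, d - k) = 1]. *)
Lemma row_free_angle_basis : row_free angle_basis.
Proof.
have md : (m.+1 <= d.+1)%N by rewrite /m; lia.
pose C := colsub (widen_ord md) angle_basis.
have Cu : C \in unitmx.
  rewrite unitmxE -det_tr det_trig.
    rewrite unitfE; apply/prodf_neq0 => i _; rewrite !mxE subSS binn.
    by rewrite mulf_neq0 ?invr_eq0 ?pnatr_eq0.
  (* In row [j] and column [i < j] of [C], the lower index [d - i] exceeds both [d - j] and [j.+1],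
     because [2 * j < d]; so both binomials vanish. *)
  apply/is_trig_mxP => i j ij; rewrite !mxE /=.
  by rewrite !bin_small ?mulr0 //; move: ij (ltn_ord j); rewrite /m; lia.
apply: inj_row_free => u u0.
have : u *m C = 0 by rewrite /C mulmx_colsub u0; apply/rowP => j; rewrite !mxE.
by move/(canRL (mulmxK Cu)); rewrite mul0mx.
Qed.

Variable p : {set 'I_d.+1} -> R.
Hypothesis p_compl : forall T, p (~: T) = p T.
Hypothesis p_set0 : p finset.set0 = 0.
Hypothesis p_sum : \sum_T p T = 1.

Definition orbit_weights : 'rV[R]_((d - 1) %/ 2).+1 :=
  \row_k \sum_(T | orbit_size T == k.+1) p T.

(** Only the empty and the full set have orbit size 0, and they are complementary. *)
Lemma p_orbit_size0 T : orbit_size T = 0%N -> p T = 0.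
Proof.
have := max_card (mem T); rewrite card_ord /orbit_size => Td E.
have [/cards0_eq -> //|T0] := posnP #|T|.
rewrite -p_compl (_ : ~: T = finset.set0) //; apply: cards0_eq.
by rewrite cardsCs finset.setCK card_ord; lia.
Qed.

Lemma sum_by_orbit (f : nat -> R) :
  \sum_T p T * f (orbit_size T) = \sum_k orbit_weights 0 k * f k.+1.
Proof.
under [RHS]eq_bigr do rewrite mxE mulr_suml big_mkcond /=.
rewrite exchange_big /=; apply: eq_bigr => T _; rewrite -big_mkcond /=.
case E : (orbit_size T) => [|k].
  by rewrite p_orbit_size0 // mul0r big1 // => k; rewrite E.
have km : (k < m.+1)%N.
  have := max_card (mem T); rewrite card_ord; move: E; rewrite /orbit_size /m; lia.
by rewrite (big_pred1 (Ordinal km)) // => i; rewrite /= eqSS eq_sym.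
Qed.

Lemma sum_orbit_weights : \sum_k orbit_weights 0 k = 1.
Proof.
have := sum_by_orbit (fun=> 1); under eq_bigr do rewrite mulr1.
by under [in RHS]eq_bigr do rewrite mulr1; rewrite p_sum.
Qed.

(** Exchanging the sums counts [T] once for each superset of size [i.+1], that is
    ['C(d.+1 - #|T|, d - i)] times. By symmetry of [p] this count may be averaged with that of the
    complement, and the average depends on the orbit size alone. *)
Lemma orbit_weights_basis (i : 'I_d.+1) :
  \sum_(S : {set 'I_d.+1} | #|S| == i.+1) \sum_(T : {set 'I_d.+1} | T \subset S) p T =
  (orbit_weights *m angle_basis) 0 i.
Proof.
have id := ltn_ord i.
pose g t := ('C(d.+1 - t, d - i))%:R : R.
transitivity (\sum_T p T * g #|T|).
  rewrite (exchange_big_dep predT) //=; apply: eq_bigr => T _.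
  rewrite sumr_const -[LHS]mulr_natr; congr (_ * _%:R).
  have := @card_supersets _ T i.+1; rewrite card_ord subSS => <- //.
  by apply: eq_card => S; rewrite !inE andbC.
transitivity (2^-1 * (\sum_T p T * g #|T| + \sum_T p T * g #|~: T|)).
  rewrite [X in _ * (_ + X)](reindex_inj (@finset.setC_inj _)) /=.
  rewrite [X in _ * (_ + X)](eq_bigr (fun T => p T * g #|T|)); first by field.
  by move=> T _; rewrite p_compl finset.setCK.
transitivity (\sum_T p T * (2^-1 * ('C(d.+1 - orbit_size T, d - i) +
    'C(orbit_size T, d - i))%:R)).
  rewrite -big_split mulr_sumr; apply: eq_bigr => T _ /=.
  rewrite -mulrDr mulrCA; congr (_ * (_ * _)); rewrite /g -natrD; congr _%:R.
  rewrite [#|~: T|]cardsCs finset.setCK card_ord.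
  have := max_card (mem T); rewrite card_ord /orbit_size => Td.
  case: leqP => _; last by rewrite addnC subKn.
  by rewrite subKn.
rewrite (sum_by_orbit (fun t => 2^-1 * ('C(d.+1 - t, d - i) + 'C(t, d - i))%:R)).
by rewrite mxE; apply: eq_bigr => k _; rewrite [angle_basis _ _]mxE.
Qed.

End AngleSums.

(** * The law of the sign pattern *)

Section SignPatterns.
Context {R : realType} {d : nat}.
Variable l : 'I_d.+1 -> 'I_d -> R.

Definition neg_set (t : d.-tuple R) : {set 'I_d.+1} := [set j | linform (l j) t < 0].

Definition neg_cell (T : {set 'I_d.+1}) : set (d.-tuple (measurableTypeR R)) :=
  [set t | neg_set t = T] `&` cball 1.

(** When [l] consists of the linear parts of barycentric coordinates, these are the directions
    pointing into the simplex from a relative interior point of the face with vertex set [S]. *)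
Definition cone (S : {set 'I_d.+1}) : set (d.-tuple (measurableTypeR R)) :=
  [set t | forall j, j \notin S -> 0 <= linform (l j) t].

Definition cell_prob (T : {set 'I_d.+1}) : R :=
  fine (vol d (neg_cell T)) / fine (vol d (@cball R d 1)).

Lemma measurable_cone S : measurable (cone S).
Proof.
rewrite (_ : cone S = \bigcap_(j in [set j : 'I_d.+1 | j \notin S])
    [set t | 0 <= linform (l j) t]); last first.
  by apply/seteqP; split => t h j; exact: h.
apply: fin_bigcap_measurable => // j _; exact: measurable_linform_ge0.
Qed.

Lemma measurable_neg_cell T : measurable (neg_cell T).
Proof.
apply: measurableI; last exact: measurable_cball.
rewrite (_ : [set t | _] = \bigcap_(j in [set: 'I_d.+1])
    (if j \in T then [set t | linform (l j) t < 0]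
     else [set t | 0 <= linform (l j) t])).
  apply: fin_bigcap_measurable => // j _; case: ifP => _.
    exact: measurable_linform_lt0.
  exact: measurable_linform_ge0.
apply/seteqP; split => t.
  move=> <- j _; rewrite inE; case: ifPn => //=; by rewrite -leNgt.
move=> h; apply/setP => j; have := h j I; rewrite inE; case: ifPn => //= _.
by rewrite leNgt => /negbTE.
Qed.

Lemma vol_cball1_gt0 : 0 < fine (vol d (@cball R d 1)).
Proof. by rewrite fine_gt0 // vol_cball_gt0 //= vol_cball_lty. Qed.

Lemma sub_cball_fin_num (A : set (d.-tuple (measurableTypeR R))) :
  measurable A -> A `<=` cball 1 -> vol d A \is a fin_num.
Proof.
move=> mA Ab; rewrite ge0_fin_numE //.
apply: le_lt_trans (vol_cball_lty d ler01).
by apply: le_measure; rewrite ?inE //; exact: measurable_cball.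
Qed.

Lemma neg_cell_fin_num T : vol d (neg_cell T) \is a fin_num.
Proof.
by apply: sub_cball_fin_num; [exact: measurable_neg_cell | move=> t []].
Qed.

Lemma cell_prob_sum (Q : pred {set 'I_d.+1}) :
  fine (vol d ([set t | Q (neg_set t)] `&` cball 1)) / fine (vol d (@cball R d 1)) =
  \sum_(T | Q T) cell_prob T.
Proof.
rewrite -mulr_suml; congr (_ / _).
rewrite (_ : _ `&` _ = \bigcup_(T in [set` enum Q]) neg_cell T); last first.
  apply/seteqP; split => t.
    by case=> h1 h2; exists (neg_set t) => //=; rewrite mem_enum.
  by case=> T /=; rewrite mem_enum => QT [/= nT hb]; split; rewrite //= nT.
rewrite measure_fin_bigcup //; last 2 first.
- by move=> T T' _ _ [t [[/= <- _] [/= <- _]]].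
- by move=> T _; exact: measurable_neg_cell.
rewrite -fsbig_seq ?enum_uniq // big_enum /=.
rewrite (eq_bigr (fun T => (fine (vol d (neg_cell T)))%:E)).
  by rewrite sumEFin.
by move=> T _; rewrite fineK // neg_cell_fin_num.
Qed.

Lemma cone_prob (S : {set 'I_d.+1}) :
  fine (vol d (cone S `&` cball 1)) / fine (vol d (@cball R d 1)) =
  \sum_(T : {set 'I_d.+1} | T \subset S) cell_prob T.
Proof.
rewrite -cell_prob_sum; congr (fine (vol d (_ `&` _)) / _).
apply/seteqP; split => t.
  move=> h /=; apply/fintype.subsetP => j; rewrite inE; apply: contraLR => /h.
  by rewrite -leNgt.
by move=> /= /fintype.subsetP h j; rewrite leNgt; apply: contra => lj; apply: h; rewrite inE.
Qed.

Lemma cell_prob_ge0 T : 0 <= cell_prob T.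
Proof. by rewrite divr_ge0 // fine_ge0. Qed.

Lemma sum_cell_prob : \sum_T cell_prob T = 1.
Proof.
rewrite -cell_prob_sum (_ : [set t | _] = setT) ?setTI.
  by rewrite divff // gt_eqF // vol_cball1_gt0.
by apply/seteqP; split.
Qed.

Lemma linform_opp (a : 'I_d -> R) t :
  linform a (homothety [tuple 0 | i < d] (-1) t) = - linform a t.
Proof.
rewrite /linform -sumrN; apply: eq_bigr => i _.
by rewrite !tnth_mktuple; ring.
Qed.

Hypothesis l_neq0 : forall j, exists i, l j i != 0.
Hypothesis l_sum0 : forall i, \sum_j l j i = 0.

Definition walls : set (d.-tuple (measurableTypeR R)) :=
  \bigcup_(j in [set: 'I_d.+1]) hyperplane (l j) 0.

Lemma measurable_walls : measurable walls.
Proof. apply: fin_bigcup_measurable => // j _; exact: measurable_hyperplane. Qed.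

Lemma vol_walls : vol d walls = 0%E.
Proof.
apply/eqP; rewrite -measure_le0.
have := @content_sub_fsum _ R _ (vol d) _ [set: 'I_d.+1] walls
  (fun j => hyperplane (l j) 0).
move/(_ finite_finset (fun j _ => measurable_hyperplane _ _) measurable_walls).
move/(_ (@subset_refl _ _))/le_trans; apply.
rewrite fsbig1 // => j _; have [i li] := l_neq0 j.
exact: (vol_hyperplane _ li).
Qed.

Lemma sum_linform t : \sum_j linform (l j) t = 0.
Proof.
rewrite /linform exchange_big /= big1 // => i _.
by rewrite -mulr_sumr l_sum0 mulr0.
Qed.

(* Negating [t] complements its sign pattern, except on the walls. *)
Lemma cell_probC T : cell_prob (~: T) = cell_prob T.
Proof.
(* Complementation is an involution, so one inequality for every [T] yields both. *)
suff {T} H T : (vol d (neg_cell T) <= vol d (neg_cell (~: T)))%E.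
  congr (_ / _); apply: le_anti; rewrite !fine_le ?neg_cell_fin_num //.
  by have := H (~: T); rewrite finset.setCK.
pose h : d.-tuple R -> d.-tuple R := homothety [tuple 0 | i < d] (-1).
rewrite (@vol_homothety _ _ [tuple 0 | i < d] (-1)) ?oppr_eq0 ?oner_eq0 //; last first.
  exact: measurable_neg_cell.
rewrite normrN1 expr1n mul1e.
have mh : measurable (h @^-1` neg_cell T).
  rewrite -[X in measurable X]setTI; apply: measurable_homothety => //.
  exact: measurable_neg_cell.
have := @measureU2 _ _ _ (vol d) (neg_cell (~: T)) walls
  (measurable_neg_cell _) measurable_walls.
rewrite [X in (_ <= _ + X)%E](_ : _ = 0%E); last exact: vol_walls.
rewrite adde0; apply: le_trans.
apply: le_measure; rewrite ?inE //.
  by apply: measurableU; [exact: measurable_neg_cell|exact: measurable_walls].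
move=> t [/= nT hb].
have [[j lj0]|nw] := pselect (exists j, linform (l j) t = 0).
  by right; exists j.
left; split.
  apply/setP => j; rewrite -nT !inE linform_opp oppr_lt0.
  rewrite -leNgt le_eqVlt; case: eqP => // lj; case: nw; by exists j.
rewrite /cball /=; move: hb; rewrite /cball /=.
by congr (_ <= _); apply: eq_bigr => i _; rewrite !tnth_mktuple; ring.
Qed.

(** Forms that are all nonnegative and sum to 0 must vanish, so this cell lies in the walls. *)
Lemma cell_prob0 : cell_prob finset.set0 = 0.
Proof.
rewrite /cell_prob (_ : vol d (neg_cell _) = 0%E) ?mul0r //.
apply: (subset_measure0 (measurable_neg_cell _) measurable_walls) vol_walls.
move=> t [/= n0 _]; exists ord0 => //.
have l_ge0 j : 0 <= linform (l j) t.
  by have := finset.in_set0 j; rewrite -n0 inE leNgt => ->.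
have /eqP := sum_linform t; rewrite psumr_eq0 // => /allP h.
by apply/eqP/h; rewrite mem_index_enum.
Qed.

End SignPatterns.

(** * Faces of a simplex *)

Lemma dot_sum (R : realType) n (u w : 'rV[R]_n) : dot u w = \sum_i u 0 i * w 0 i.
Proof. by rewrite /dot mxE; apply: eq_bigr => i _; rewrite mxE. Qed.

Lemma dot_ge0 (R : realType) n (u : 'rV[R]_n) : 0 <= dot u u.
Proof. by rewrite dot_sum sumr_ge0 // => i _; exact: sqr_ge0. Qed.

Lemma eballE (R : realType) n (x y : 'rV[R]_n) r : 0 <= r ->
  eball x r y <-> dot (y - x) (y - x) <= r ^+ 2.
Proof.
move=> r0; rewrite /eball /= -[X in (_ <= X) <-> _]ger0_norm // -sqrtr_sqr.
by rewrite ler_sqrt // sqr_ge0.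
Qed.

Lemma eball_entry (R : realType) n (x y : 'rV[R]_n) r i : 0 <= r ->
  eball x r y -> `|(y - x) 0 i| <= r.
Proof.
move=> r0 /(eballE _ _ r0) h; rewrite -(@ler_pXn2r _ 2) ?nnegrE //.
rewrite real_normK ?num_real //; apply: le_trans h.
rewrite dot_sum (bigD1 i) //= -expr2 lerDl sumr_ge0 // => j _; exact: sqr_ge0.
Qed.

(** Every direction of a flat is a difference of two of its points, so the flat determines the row
    space. *)
Lemma flat_rank (R : realType) n k k' (x x' : 'rV[R]_n)
    (B : 'M[R]_(k, n)) (B' : 'M[R]_(k', n)) :
  row_free B -> row_free B' -> flat x B = flat x' B' -> k = k'.
Proof.
suff sub k1 k2 (x1 x2 : 'rV[R]_n) (B1 : 'M[R]_(k1, n)) (B2 : 'M[R]_(k2, n)) :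
    flat x1 B1 = flat x2 B2 -> (B1 <= B2)%MS.
  move=> /eqP Bf /eqP Bf' E; apply/eqP; rewrite eqn_leq.
  have h1 := mxrankS (sub _ _ _ _ _ _ E).
  have h2 := mxrankS (sub _ _ _ _ _ _ (esym E)).
  by move: h1 h2; rewrite Bf Bf' => -> ->.
move=> E; apply/rV_subP => w /submxP[u ->].
have : flat x1 B1 x1 by exists 0 => //; rewrite mul0mx addr0.
have : flat x1 B1 (x1 + u *m B1) by exists u.
rewrite E => -[u1 _ E1] [u0 _ E0].
apply/submxP; exists (u1 - u0); rewrite mulmxBl.
by apply: (addrI x1); rewrite -E1 -{1}E0; rewrite addrCA addrK addrC.
Qed.

(** Affine independence makes the rows of [V], extended by a column of ones, linearly independent. A
    right inverse of this matrix, split into its top block and its last row, gives [L] and [c]. *)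
Lemma row_free_bary (R : realType) n d (V : 'M[R]_(d, n)) :
  aff_indep (fun j => row j V) -> exists (L : 'M[R]_(n, d)) (c : 'rV[R]_d),
    forall s : 'rV_d, \sum_j s 0 j = 1 -> s *m V *m L + c = s.
Proof.
move=> Vind; pose H := row_mx V (const_mx 1 : 'cV_d).
have HE (s : 'rV_d) : s *m H = row_mx (s *m V) (const_mx (\sum_j s 0 j)).
  rewrite mul_mx_row; congr (row_mx _ _); apply/rowP => i; rewrite !mxE.
  by apply: eq_bigr => j _; rewrite mxE mulr1.
have /row_freeP[W HW] : row_free H.
  apply: inj_row_free => u; rewrite HE -[RHS]row_mx0 => /eq_row_mx[uV us].
  apply/rowP => j; rewrite mxE; apply: (Vind (fun j => u 0 j)).
    by have /rowP/(_ 0) := us; rewrite !mxE.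
  by rewrite -mulmx_sum_row.
exists (usubmx W), (dsubmx W) => s s1.
rewrite -[RHS](mulmx1 s) -HW mulmxA HE s1 -{3}[W]vsubmxK mul_row_col.
congr (_ + _); apply/rowP => j.
by rewrite [RHS]mxE big_ord1 [const_mx _ _ _]mxE mul1r.
Qed.

Lemma aff_hull_aff_combs (R : realType) n k (B : 'M[R]_(k, n)) (S : set 'rV[R]_n) :
  (forall i, S (row i B)) -> S `<=` aff_combs B -> aff_hull S = aff_combs B.
Proof.
move=> BS SB; apply/seteqP; split => [|x]; first exact: aff_hull_sub_aff_combs.
move=> [s /= s1 <-]; exists k, (fun i => s 0 i), (fun j => row j B); split => //.
exact: mulmx_sum_row.
Qed.

(** The number of rows stays a variable [p], so that the statement applies to [#|S|] rows without a
    cast. *)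
Lemma aff_dim_aff_combs (R : realType) n p k' k (B : 'M[R]_(p, n)) : p = k'.+1 ->
  (forall w : 'rV_p, \sum_j w 0 j = 0 -> w *m B = 0 -> w = 0) ->
  (exists x (D : 'M[R]_(k, n)), row_free D /\ aff_combs B = flat x D) <-> k'.+1 = k.+1.
Proof.
move=> pk; subst p => Bind; rewrite aff_combs_flat.
have Dfree : row_free (diff_mx *m B).
  apply: inj_row_free => u; rewrite mulmxA => uB.
  have u0 : u *m diff_mx = 0.
    apply: Bind => //; rewrite big_ord_recl mul_diff_mx0.
    by under [X in _ + X]eq_bigr do rewrite mul_diff_mx; rewrite addNr.
  by apply/rowP => i; rewrite -mul_diff_mx u0 !mxE.
split=> [[x [D [Df E]]]|[<-]].
  by congr _.+1; exact: flat_rank Dfree Df E.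
by exists (row ord0 B), (diff_mx *m B).
Qed.

(* [bary x = x *m L + c] extends the barycentric coordinates with respect to the
   rows of [V] to an affine map on the whole space. *)
Section Simplex.
Context {R : realType} {n d : nat}.
Variables (V : 'M[R]_(d.+1, n)) (L : 'M[R]_(n, d.+1)) (c : 'rV[R]_d.+1).
Hypothesis bary_comb : forall s : 'rV_d.+1, \sum_j s 0 j = 1 -> s *m V *m L + c = s.

Definition bary (x : 'rV[R]_n) : 'rV[R]_d.+1 := x *m L + c.

Lemma baryE x : bary x = x *m L + c.
Proof. by []. Qed.

Lemma bary_aff x : aff_combs V x -> x = bary x *m V /\ \sum_j bary x 0 j = 1.
Proof. by case=> s /= s1 <-; rewrite /bary bary_comb. Qed.

Lemma bary_comb_vertices (s : 'rV_d.+1) : \sum_j s 0 j = 1 -> bary (s *m V) = s.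
Proof. exact: bary_comb. Qed.

Lemma sum_delta_row k (j : 'I_k) : \sum_i (delta_mx 0 j : 'rV[R]_k) 0 i = 1.
Proof.
rewrite (bigD1 j) //= big1 => [|i ij]; first by rewrite mxE !eqxx addr0.
by rewrite mxE (negbTE ij) andbF.
Qed.

Lemma bary_vertex j : bary (row j V) = delta_mx 0 j.
Proof. by rewrite rowE bary_comb_vertices // sum_delta_row. Qed.

Lemma bary_segment x y (a : R) j :
  bary (x + a *: (y - x)) 0 j = (1 - a) * bary x 0 j + a * bary y 0 j.
Proof.
rewrite /bary mulmxDl -scalemxAl mulmxBl !mxE; ring.
Qed.

Lemma aff_combs_segment x y (a : R) :
  aff_combs V x -> aff_combs V y -> aff_combs V (x + a *: (y - x)).
Proof.
move=> [s /= s1 <-] [t /= t1 <-]; exists (s + a *: (t - s)).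
  rewrite /=; under eq_bigr do rewrite !mxE.
  by rewrite big_split /= -mulr_sumr sumrB s1 t1 subrr mulr0 addr0.
by rewrite mulmxDl -scalemxAl mulmxBl.
Qed.

Definition simplex_face (S : {set 'I_d.+1}) : set 'rV[R]_n :=
  [set x | [/\ aff_combs V x, forall j, 0 <= bary x 0 j &
               forall j, j \notin S -> bary x 0 j = 0]].

Lemma simplex_faceE (S : {set 'I_d.+1}) x : simplex_face S x <->
  exists s : 'rV_d.+1, [/\ forall j, 0 <= s 0 j, \sum_j s 0 j = 1,
    forall j, j \notin S -> s 0 j = 0 & x = s *m V].
Proof.
split=> [[xV x0 xS]|[s [s0 s1 sS ->]]].
  by have [xE x1] := bary_aff xV; exists (bary x).
by split; rewrite ?bary_comb_vertices //; exists s.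
Qed.

Lemma vertex_face (S : {set 'I_d.+1}) j : simplex_face S (row j V) <-> j \in S.
Proof.
split=> [[_ _ h]|jS].
  apply/negPn/negP => /h; rewrite bary_vertex mxE !eqxx => /eqP.
  by rewrite oner_eq0.
apply/simplex_faceE; exists (delta_mx 0 j); split.
- by move=> i; rewrite mxE ler0n.
- exact: sum_delta_row.
- by move=> i iS; rewrite mxE eqxx; case: eqP iS => // ->; rewrite jS.
- exact: rowE.
Qed.

Lemma simplex_face_subset (S T : {set 'I_d.+1}) :
  simplex_face S `<=` simplex_face T -> S \subset T.
Proof. by move=> h; apply/fintype.subsetP => j /vertex_face/h/vertex_face. Qed.

Lemma subset_simplex_face (S T : {set 'I_d.+1}) :
  S \subset T -> simplex_face S `<=` simplex_face T.
Proof.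
move=> /fintype.subsetP ST x [xV x0 xS]; split => // j jT.
by apply: xS; apply: contra jT; exact: ST.
Qed.

Lemma simplex_face_inj : injective simplex_face.
Proof.
move=> S T E; apply/eqP; rewrite finset.eqEsubset.
by rewrite !simplex_face_subset // E.
Qed.

Lemma conv_hull_simplex : conv_hull (range (fun j => row j V)) = simplex_face finset.setT.
Proof.
apply/seteqP; split => x.
  move=> [k [w [p [pV w0 w1 ->]]]].
  have /choice[f fP] i : exists j, row j V = p i.
    by have [j _ <-] := pV i; exists j.
  apply/simplex_faceE; exists (\sum_i w i *: delta_mx 0 (f i)); split.
  - move=> j; rewrite summxE sumr_ge0 // => i _; rewrite !mxE.
    by rewrite mulr_ge0 // ler0n.
  - by apply: sum_entries_combination => // i; exact: sum_delta_row.
  - by move=> j; rewrite finset.in_setT.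
  - by rewrite -sum_affine_combination; apply: eq_bigr => i _; rewrite -rowE fP.
move/simplex_faceE => [s [s0 s1 _ ->]].
exists d.+1, (fun j => s 0 j), (fun j => row j V); split => //.
exact: mulmx_sum_row.
Qed.

Let P := conv_hull (range (fun j => row j V)).

Lemma aff_hull_conv_hull : aff_hull P = aff_combs V.
Proof.
rewrite /P conv_hull_simplex; apply: aff_hull_aff_combs => [i|x []//].
by apply/vertex_face; rewrite finset.in_setT.
Qed.

Lemma dot_comb (u : 'rV[R]_n) (s : 'rV[R]_d.+1) :
  dot u (s *m V) = \sum_j s 0 j * dot u (row j V).
Proof.
rewrite dot_sum; under eq_bigr do rewrite mxE mulr_sumr.
rewrite exchange_big /=; apply: eq_bigr => j _; rewrite dot_sum mulr_sumr.
by apply: eq_bigr => i _; rewrite mxE mulrCA.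
Qed.

(** Up to a constant this functional is minus the sum of the coordinates outside [S]. On the simplex
    it is maximal exactly where these vanish, so it exposes the face of [S]. *)
Lemma dot_bary (S : {set 'I_d.+1}) x :
  dot (- \sum_(j | j \notin S) (col j L)^T) x =
  \sum_(j | j \notin S) c 0 j - \sum_(j | j \notin S) bary x 0 j.
Proof.
rewrite -sumrB dot_sum.
under [RHS]eq_bigr do rewrite !mxE opprD addrCA subrr addr0 -sumrN.
rewrite exchange_big /=; apply: eq_bigr => i _.
rewrite mxE summxE -sumrN mulr_suml; apply: eq_bigr => j _.
by rewrite !mxE mulNr mulrC.
Qed.

Lemma is_faceP G : is_face G P <->
  exists2 S : {set 'I_d.+1}, S != finset.set0 & G = simplex_face S.
Proof.
rewrite /is_face /P conv_hull_simplex; split.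
  move=> [[x0 Gx0] [u [b [ub GE]]]].
  have vb j : dot u (row j V) <= b by apply: ub; apply/vertex_face; rewrite finset.in_setT.
  (* A convex combination of the vertices attains the bound [b] only if all its weight lies on
     vertices attaining it. *)
  pose S := [set j | dot u (row j V) == b]%SET.
  have GS : G = simplex_face S.
    rewrite GE; apply/seteqP; split => x.
      move=> [[xV x_ge0 _] /= xb]; split => // j; rewrite inE => jb.
      have [xE x1] := bary_aff xV.
      have /eqP : \sum_j bary x 0 j * (b - dot u (row j V)) = 0.
        under eq_bigr do rewrite mulrBr.
        by rewrite sumrB -dot_comb -xE -mulr_suml x1 mul1r xb subrr.
      rewrite psumr_eq0 => [|k _]; last by rewrite mulr_ge0 // subr_ge0.
      move/allP/(_ j (mem_index_enum _)); rewrite implyTb mulf_eq0 subr_eq0.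
      by rewrite [b == _]eq_sym (negbTE jb) orbF => /eqP.
    move=> xS; split; first by apply: subset_simplex_face xS; exact: finset.subsetT.
    case: xS => xV _ xS; have [xE x1] := bary_aff xV.
    rewrite /= xE dot_comb -[RHS]mul1r -x1 mulr_suml; apply: eq_bigr => j _.
    have [jS|/xS ->] := boolP (j \in S); last by rewrite !mul0r.
    by move: jS; rewrite inE => /eqP ->.
  exists S => //; apply/eqP => S0; move: Gx0; rewrite GS S0 => -[/bary_aff[_ x1] _ h].
  have /eqP := x1; rewrite big1 => [|j _]; first by rewrite eq_sym oner_eq0.
  by apply: h; rewrite finset.in_set0.
move=> [S /finset.set0Pn[j jS] ->]; split; first by exists (row j V); apply/vertex_face.
exists (- \sum_(j | j \notin S) (col j L)^T), (\sum_(j | j \notin S) c 0 j).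
split=> [x [_ x0 _]|].
  by rewrite dot_bary gerBl sumr_ge0.
apply/seteqP; split => x /=.
  move=> xS; split; first by apply: subset_simplex_face xS; exact: finset.subsetT.
  case: xS => _ _ xS; rewrite dot_bary [X in _ - X]big1 ?subr0 // => i; exact: xS.
move=> [[xV x0 _]]; rewrite dot_bary => /eqP; rewrite subr_eq addrC -subr_eq subrr.
rewrite eq_sym psumr_eq0 // => /allP h; split => // i iS.
by have := h i (mem_index_enum _); rewrite iS => /eqP.
Qed.

Definition face_vertices (S : {set 'I_d.+1}) : 'M[R]_(#|S|, n) := rowsub enum_val V.

Lemma comb_face_vertices (S : {set 'I_d.+1}) (s : 'rV[R]_d.+1) :
  (forall j, j \notin S -> s 0 j = 0) ->
  s *m V = colsub enum_val s *m face_vertices S /\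
  \sum_j s 0 j = \sum_i (colsub (@enum_val _ (mem S)) s) 0 i.
Proof.
move=> sS; split.
  rewrite !mulmx_sum_row (bigID (mem S)) /= [X in _ + X]big1 => [|j jS]; last first.
    by rewrite sS // scale0r.
  rewrite addr0 big_enum_val; apply: eq_bigr => i _.
  by rewrite mxE row_rowsub.
rewrite (bigID (mem S)) /= [X in _ + X]big1 => [|j jS]; last by rewrite sS.
by rewrite addr0 big_enum_val; apply: eq_bigr => i _; rewrite mxE.
Qed.

Lemma aff_hull_face (S : {set 'I_d.+1}) :
  aff_hull (simplex_face S) = aff_combs (face_vertices S).
Proof.
apply: aff_hull_aff_combs => [i|x /simplex_faceE[s [_ s1 sS ->]]].
  by rewrite row_rowsub; apply/vertex_face; exact: enum_valP.
have [-> s1'] := comb_face_vertices sS.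
by exists (colsub enum_val s) => //=; rewrite -s1'.
Qed.

(** Shifting by a unit vector gives weights of sum 1, which [bary_comb] recovers from the point they
    represent. *)
Lemma vertices_aff_indep (w : 'rV[R]_d.+1) :
  \sum_j w 0 j = 0 -> w *m V = 0 -> w = 0.
Proof.
move=> w0 wV; pose e : 'rV[R]_d.+1 := delta_mx 0 ord0.
have e1 : \sum_j e 0 j = 1 by exact: sum_delta_row.
apply: (addrI e); rewrite addr0 -[RHS](bary_comb e1) -[LHS]bary_comb.
  by rewrite mulmxDl wV addr0.
by under eq_bigr do rewrite mxE; rewrite big_split /= e1 w0 addr0.
Qed.

Lemma aff_dim_face (S : {set 'I_d.+1}) k :
  S != finset.set0 -> aff_dim (simplex_face S) k <-> #|S| = k.+1.
Proof.
move=> /finset.set0Pn[j jS]; rewrite /aff_dim aff_hull_face.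
have S1 : #|S| = #|S|.-1.+1 by rewrite prednK //; apply/card_gt0P; exists j.
rewrite [X in _ <-> X = _]S1; apply: (aff_dim_aff_combs _ S1) => w w0 wS.
(* [E] pads weights on [S] with zeros to weights on all vertices. *)
pose E : 'M[R]_(#|S|, d.+1) := rowsub enum_val 1%:M.
have EV : face_vertices S = E *m V by rewrite mul_rowsub_mx mul1mx.
have wE : w *m E = 0.
  apply: vertices_aff_indep; last by rewrite -mulmxA -EV.
  under eq_bigr do rewrite mxE; rewrite exchange_big /= -[RHS]w0.
  apply: eq_bigr => i _; rewrite -mulr_sumr (bigD1 (enum_val i)) //=.
  rewrite !mxE eqxx big1 ?addr0 ?mulr1 // => i' ii'.
  by rewrite !mxE eq_sym (negbTE ii').
apply/rowP => i; have /rowP/(_ (enum_val i)) := wE.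
rewrite !mxE (bigD1 i) //= !mxE eqxx mulr1 big1 ?addr0 // => i' ii'.
by rewrite !mxE (inj_eq enum_val_inj) (negbTE ii') mulr0.
Qed.

Lemma angle_sum_simplex (i : nat) :
  angle_sum d P i =
  \sum_(S : {set 'I_d.+1} | #|S| == i.+1) int_angle d (simplex_face S) P.
Proof.
rewrite /angle_sum (_ : [set F | _] =
    simplex_face @` [set S | S \in enum [pred S : {set 'I_d.+1} | #|S| == i.+1]]).
  rewrite fsbig_image; last by move=> S T _ _; exact: simplex_face_inj.
  by rewrite -fsbig_seq ?enum_uniq // big_enum.
apply/seteqP; split => [F [/is_faceP[S S0 FE]]|F [S /=]].
  by rewrite FE => /(aff_dim_face _ S0) Si; exists S => //=; rewrite mem_enum inE Si.
rewrite mem_enum inE => /eqP Si <-.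
have S0 : S != finset.set0 by rewrite -card_gt0 Si.
by split; [apply/is_faceP; exists S | apply/aff_dim_face].
Qed.

End Simplex.

(** * Interior angles of a simplex *)

(** Gram-Schmidt: the rows after the first are made orthonormal by induction, then the first row is
    projected off their span and normalized. *)
Lemma orthonormal_basis (R : realType) n k (A : 'M[R]_(k, n)) : row_free A ->
  exists B : 'M[R]_(k, n), B *m B^T = 1%:M /\ (A :=: B)%MS.
Proof.
elim: k A => [|k IH] A Afree.
  by exists A; split; [apply/matrixP => -[] | exact: eqmx_refl].
rewrite -[k.+1]/(1 + k)%N in A Afree *.
move: Afree; rewrite -[A]vsubmxK; move: (usubmx A) (dsubmx A) => a A' Afree.
have A'free : row_free A'.
  apply: inj_row_free => u uA; have : row_mx 0 u *m col_mx a A' = 0.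
    by rewrite mul_row_col mul0mx add0r.
  rewrite -(mul0mx _ (col_mx a A')) => /(row_free_inj Afree).
  by rewrite -row_mx0 => /eq_row_mx[].
have [B' [B'1 AB']] := IH _ A'free.
pose b := a - a *m B'^T *m B'.
have bB' : b *m B'^T = 0 by rewrite mulmxBl -!mulmxA B'1 mulmx1 subrr.
have b0 : b != 0.
  apply/eqP => /eqP; rewrite subr_eq0 => /eqP aE.
  have /submxP[u au] : (a <= A')%MS by rewrite AB' aE submxMl.
  have : row_mx 1%:M (- u) *m col_mx a A' = 0.
    by rewrite mul_row_col mul1mx mulNmx -au subrr.
  rewrite -(mul0mx _ (col_mx a A')) => /(row_free_inj Afree).
  rewrite -row_mx0 => /eq_row_mx[/matrixP/(_ 0 0)]; rewrite !mxE => /eqP.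
  by rewrite oner_eq0.
have bb_gt0 : 0 < dot b b.
  rewrite lt_neqAle dot_ge0 andbT eq_sym; apply: contra b0 => /eqP bb.
  apply/eqP/rowP => i; rewrite [RHS]mxE; apply/eqP; rewrite -sqrf_eq0.
  move: bb; rewrite dot_sum => /eqP; rewrite psumr_eq0 => [|j _]; last exact: sqr_ge0.
  by move=> /allP/(_ i (mem_index_enum _)).
pose q := Num.sqrt (dot b b); have q0 : q != 0 by rewrite gt_eqF // sqrtr_gt0.
have qq : q * q = dot b b by rewrite -expr2 sqr_sqrtr // ltW.
pose e := q^-1 *: b; exists (col_mx e B'); split.
  rewrite tr_col_mx mul_col_row B'1 /e -!scalemxAl bB' scaler0.
  rewrite (_ : B' *m _ = 0); last first.
    by rewrite linearZ /= -scalemxAr -[B']trmxK -trmx_mul bB' trmx0 scaler0.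
  rewrite (_ : _ *: _ = 1%:M) -?scalar_mx_block //.
  rewrite linearZ /= -scalemxAr [b *m _]mx11_scalar -/(dot b b) !scale_scalar_mx.
  by rewrite -qq; congr _%:M; field.
apply/eqmxP/andP; split.
  rewrite !col_mx_sub AB' -!addsmxE addsmxSr andbT.
  have -> : a = q *: e + a *m B'^T *m B'.
    by rewrite /e scalerA mulfV // scale1r /b subrK.
  by apply: addmx_sub_adds; [exact: scalemx_sub | exact: submxMl].
rewrite !col_mx_sub -AB' -!addsmxE addsmxSr andbT.
rewrite /e scalemx_sub // /b addmx_sub_adds // ?eqmx_opp //.
by rewrite AB' submxMl.
Qed.

Lemma flat_eqmx (R : realType) n k k' (x : 'rV[R]_n) (A : 'M[R]_(k, n)) (B : 'M[R]_(k', n)) :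
  (A :=: B)%MS -> flat x A = flat x B.
Proof.
move=> AB; apply/seteqP; split => y [u _ <-].
  have /submxP[w ->] : (u *m A <= B)%MS by rewrite -AB submxMl.
  by exists w.
have /submxP[w ->] : (u *m B <= A)%MS by rewrite AB submxMl.
by exists w.
Qed.

Lemma relvolE (R : realType) n d (P A : 'rV[R]_n -> Prop) :
  relvol d P A = vol d [set t : d.-tuple R |
    A ((frame d P).1 + (\row_i tnth t i) *m (frame d P).2)].
Proof. by rewrite /relvol; case: (frame d P). Qed.

Section InteriorAngles.
Context {R : realType} {n d : nat}.
Variables (V : 'M[R]_(d.+1, n)) (L : 'M[R]_(n, d.+1)) (c : 'rV[R]_d.+1).
Hypothesis bary_comb : forall s : 'rV_d.+1, \sum_j s 0 j = 1 -> s *m V *m L + c = s.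
Hypothesis d_gt0 : (0 < d)%N.

Local Notation bary := (bary L c).
Local Notation simplex_face := (simplex_face V L c).
Let P := conv_hull (range (fun j => row j V)).
Let x0 := (frame d P).1.
Let B0 := (frame d P).2.

(** Orthonormalizing the edge directions at vertex 0 shows that a frame exists, so [frame] does not
    return its default value. *)
Lemma frame_simplex : B0 *m B0^T = 1%:M /\ aff_combs V = flat x0 B0.
Proof.
have /orthonormal_basis[B [B1 VB]] : row_free (diff_mx *m V).
  apply: inj_row_free => u; rewrite mulmxA => uV.
  have u0 : u *m diff_mx = 0.
    apply: (vertices_aff_indep bary_comb) => //; rewrite big_ord_recl mul_diff_mx0.
    by under [X in _ + X]eq_bigr do rewrite mul_diff_mx; rewrite addNr.
  by apply/rowP => i; rewrite -mul_diff_mx u0 !mxE.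
have : exists z, is_frame (d := d) P z.
  exists (row ord0 V, B); split => //=.
  by rewrite (aff_hull_conv_hull bary_comb) aff_combs_flat; exact: flat_eqmx.
by move/(xgetPex (0, 0)) => -[]; rewrite (aff_hull_conv_hull bary_comb).
Qed.

(** The linear part of barycentric coordinate [j], in the orthonormal coordinates of the frame. *)
Definition bary_form (j : 'I_d.+1) (i : 'I_d) : R := (B0 *m L) i j.

Local Notation pt t := (x0 + (\row_i tnth t i) *m B0).

Lemma pt_aff (t : d.-tuple R) : aff_combs V (pt t).
Proof. by have [_ ->] := frame_simplex; exists (\row_i tnth t i). Qed.

Lemma pt_onto y : aff_combs V y -> exists t : d.-tuple R, y = pt t.
Proof.
have [_ ->] := frame_simplex => -[u _ <-].
exists [tuple u 0 i | i < d]; congr (_ + _ *m _).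
by apply/rowP => i; rewrite mxE tnth_mktuple.
Qed.

Lemma bary_formE (t : d.-tuple R) j :
  linform (bary_form j) t = ((\row_i tnth t i) *m B0 *m L) 0 j.
Proof. by rewrite -mulmxA mxE; apply: eq_bigr => i _; rewrite [X in _ = X * _]mxE. Qed.

Lemma bary_pt (t : d.-tuple R) j :
  bary (pt t) 0 j = bary x0 0 j + linform (bary_form j) t.
Proof. by rewrite bary_formE !baryE mulmxDl !mxE; ring. Qed.

Lemma pt_homothety (t u : d.-tuple R) (r : R) :
  pt (homothety t r u) = pt t + r *: ((\row_i tnth u i) *m B0).
Proof.
rewrite -addrA scalemxAl -mulmxDl; congr (_ + _ *m _).
by apply/rowP => i; rewrite !mxE tnth_mktuple.
Qed.

Lemma dot_frame (u : 'rV[R]_d) : dot (u *m B0) (u *m B0) = \sum_i u 0 i ^+ 2.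
Proof.
have [BB _] := frame_simplex.
rewrite /dot trmx_mul mulmxA -(mulmxA u) BB mulmx1 mxE.
by apply: eq_bigr => i _; rewrite mxE.
Qed.

Lemma eball_pt (t u : d.-tuple R) (r : R) : 0 < r ->
  eball (pt t) r (pt (homothety t r u)) <-> cball 1 u.
Proof.
move=> r0; rewrite (eballE _ _ (ltW r0)) pt_homothety addrAC subrr add0r.
rewrite scalemxAl dot_frame /cball /= expr1n.
under eq_bigr do rewrite !mxE exprMn.
by rewrite -mulr_sumr -[X in _ <= X]mulr1 ler_pM2l ?exprn_gt0.
Qed.

(** The barycentric coordinates sum to 1 at the origin of the frame and at its translate by basis
    vector [i]; the claim is the difference. *)
Lemma sum_bary_form i : \sum_j bary_form j i = 0.
Proof.
pose t : d.-tuple R := [tuple (i == k)%:R | k < d].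
pose z : d.-tuple R := [tuple 0 | k < d].
have linz j : linform (bary_form j) z = 0.
  by rewrite /linform big1 // => k _; rewrite tnth_mktuple mul0r.
have lint j : linform (bary_form j) t = bary_form j i.
  rewrite /linform (bigD1 i) //= tnth_mktuple eqxx mul1r big1 ?addr0 // => k ki.
  by rewrite tnth_mktuple eq_sym (negbTE ki) mul0r.
have [_ zs] := bary_aff bary_comb (pt_aff z).
have [_] := bary_aff bary_comb (pt_aff t); rewrite -zs => /eqP.
rewrite -subr_eq0 -sumrB => /eqP E; rewrite -[RHS]E; apply: eq_bigr => j _.
by rewrite !bary_pt linz lint; ring.
Qed.

(** Coordinate [j] is 1 at vertex [j] and 0 at any other vertex, which exists because [0 < d]; so it
    is not constant. *)
Lemma bary_form_neq0 j : exists i, bary_form j i != 0.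
Proof.
apply/not_existsP => h.
have linj t : linform (bary_form j) t = 0.
  rewrite /linform big1 // => i _; have /negP/negPn/eqP -> := h i.
  by rewrite mulr0.
have bj y : aff_combs V y -> bary y 0 j = bary x0 0 j.
  by move=> /pt_onto[t ->]; rewrite bary_pt linj addr0.
have rV k : aff_combs V (row k V).
  by exists (delta_mx 0 k); [exact: sum_delta_row | rewrite rowE].
have [k kj] : exists k : 'I_d.+1, k != j.
  by exists (lift j (Ordinal d_gt0)); rewrite eq_sym neq_lift.
have := bj _ (rV j); rewrite -(bj _ (rV k)) !(bary_vertex bary_comb) !mxE !eqxx /=.
by rewrite eq_sym (negbTE kj) => /eqP; rewrite oner_eq0.
Qed.

Section Face.
Variable S : {set 'I_d.+1}.
Hypothesis S_neq0 : S != finset.set0.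

(** If [y] had negative coordinates, follow the segment from [x] to [y] until one of them, say [k],
    first vanishes. This point lies in the ball and on the facet opposite vertex [k]. By
    admissibility that facet contains the face of [S], although [k \in S]. *)
Lemma admissible_ball x r y : simplex_face S x -> 0 < r ->
  (forall G, is_face G P -> eball x r `&` G !=set0 -> simplex_face S `<=` G) ->
  aff_combs V y -> eball x r y -> (forall j, j \notin S -> 0 <= bary y 0 j) ->
  forall j, 0 <= bary y 0 j.
Proof.
move=> [xV x_ge0 xS] r0 adm yV yb y_ge0 j; rewrite leNgt; apply/negP => yj.
(* The parameter at which coordinate [k] vanishes on the segment. *)
pose f k := bary x 0 k / (bary x 0 k - bary y 0 k).
have [k /= yk kmin] := @arg_minP _ _ _ j (fun k => bary y 0 k < 0) f yj.
have den_gt0 i : bary y 0 i < 0 -> 0 < bary x 0 i - bary y 0 i.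
  by move=> yi; have := x_ge0 i; lra.
have f_ge0 : 0 <= f k by rewrite divr_ge0 // ltW // den_gt0.
have f_le1 : f k <= 1 by rewrite ler_pdivrMr ?den_gt0 // mul1r; lra.
pose z := x + f k *: (y - x).
have zk : bary z 0 k = 0.
  by rewrite bary_segment /f; field; rewrite gt_eqF // den_gt0.
have zV : aff_combs V z by exact: aff_combs_segment.
have z_ge0 i : 0 <= bary z 0 i.
  rewrite bary_segment; have [yi|yi] := ltP (bary y 0 i) 0.
    have := kmin i yi; rewrite {2}/f ler_pdivlMr ?den_gt0 //; nra.
  by rewrite addr_ge0 // mulr_ge0 // subr_ge0.
have zb : eball x r z.
  rewrite (eballE _ _ (ltW r0)) /z addrC addKr.
  move/(eballE _ _ (ltW r0)): yb; apply: le_trans.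
  rewrite dot_sum [leRHS]dot_sum; apply: ler_sum => i _.
  rewrite mxE mulrACA -[leRHS]mul1r -!expr2 ler_wpM2r ?sqr_ge0 //.
  by rewrite -(expr1n _ 2) ler_pXn2r ?nnegrE.
pose T := [set~ k]%SET.
have zT : simplex_face T z.
  by split => // i; rewrite !inE negbK => /eqP ->.
have T0 : T != finset.set0.
  by apply/finset.set0Pn; exists (lift k (Ordinal d_gt0)); rewrite !inE eq_sym neq_lift.
have fT : is_face (simplex_face T) P by apply/(is_faceP bary_comb); exists T.
have ST := adm _ fT (ex_intro _ z (conj zb zT)).
have kS : k \in S by apply/negPn/negP => /y_ge0; rewrite leNgt yk.
have : simplex_face T (row k V) by apply/ST/(vertex_face bary_comb).
by move/(vertex_face bary_comb); rewrite !inE eqxx.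
Qed.

Lemma fine_vol_homothety (x : d.-tuple R) (r : R) (A : set (d.-tuple (measurableTypeR R))) :
  0 < r -> measurable (homothety x r @^-1` A) ->
  fine (vol d A) = r ^+ d * fine (vol d (homothety x r @^-1` A)).
Proof.
move=> r0 mA; pose y : d.-tuple R := [tuple - (r^-1 * tnth x i) | i < d].
have K : cancel (homothety y r^-1) (homothety x r).
  move=> t; apply: eq_from_tnth => i; rewrite !tnth_mktuple; field.
  by rewrite gt_eqF.
have AE : A = homothety y r^-1 @^-1` (homothety x r @^-1` A).
  by apply/funext => t; rewrite /preimage /= K.
have mA' : measurable A.
  rewrite AE -[X in measurable X]setTI; exact: measurable_homothety.
have rn0 : r != 0 by rewrite gt_eqF.
rewrite (vol_homothety x rn0 mA') gtr0_norm //.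
(* Since [fine] sends [+oo] to 0, the identity survives an infinite volume. *)
have [->|] := eqVneq (vol d (homothety x r @^-1` A)) +oo%E.
  by rewrite mulry gtr0_sg ?exprn_gt0 // mul1e mulr0.
move=> h; rewrite fineM // fin_numE h andbT.
by rewrite gt_eqF // (lt_le_trans _ (measure_ge0 _ _)).
Qed.

(** Rescaling the ball around [x] to the unit ball turns the simplex into [cone bary_form S]:
    coordinates outside [S] vanish at [x], and those in [S] impose no condition by
    [admissible_ball]. The factors [r ^+ d] cancel, so every admissible ball gives this value. *)
Lemma int_angle_value a : is_int_angle d (simplex_face S) P a ->
  a = \sum_(T : {set 'I_d.+1} | T \subset S) cell_prob bary_form T.
Proof.
move=> [x [r [[xS _] r0 adm ->]]].
have [xV x_ge0 xS0] := xS.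
have [t xt] := pt_onto xV.
rewrite !relvolE -/x0 -/B0 -cone_prob.
have bE : homothety t r @^-1` [set u | eball x r (pt u)] = cball 1.
  by apply/seteqP; split => u; rewrite /preimage /= xt => /(eball_pt _ _ r0).
have cE : homothety t r @^-1` [set u | (eball x r `&` P) (pt u)] =
    cone bary_form S `&` cball 1.
  have bpt u j : bary (pt (homothety t r u)) 0 j =
      bary x 0 j + r * linform (bary_form j) u.
    rewrite pt_homothety -xt bary_formE !baryE.
    by rewrite mulmxDl -scalemxAl !mxE; ring.
  rewrite /P (conv_hull_simplex bary_comb); apply/seteqP; split => u.
    move=> [/= ub [_ h _]]; split; last by apply/(eball_pt t _ r0); rewrite -xt.
    move=> j jS; have := h j; rewrite bpt xS0 // add0r pmulr_rge0 //.
  move=> [uS ub]; split; rewrite /=.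
    by rewrite xt; apply/eball_pt.
  split; [exact: pt_aff| |by move=> j; rewrite finset.in_setT].
  apply: (admissible_ball xS r0 adm); first exact: pt_aff.
    by rewrite xt; apply/eball_pt.
  by move=> j jS; rewrite bpt xS0 // add0r mulr_ge0 ?(ltW r0) //; exact: uS.
rewrite (@fine_vol_homothety t r [set u | (eball x r `&` P) (pt u)]) //; last first.
  by rewrite cE; apply: measurableI; [exact: measurable_cone | exact: measurable_cball].
rewrite (@fine_vol_homothety t r [set u | eball x r (pt u)]) //; last first.
  by rewrite bE; exact: measurable_cball.
rewrite bE cE; field.
by rewrite !gt_eqF ?exprn_gt0 // vol_cball1_gt0.
Qed.

(** The centre is the barycentre of the face, where each coordinate in [S] is at least
    [1 / (d + 1)]; on the chosen ball it changes by at most half of that. These coordinates thus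
    stay positive, which gives both relative interiority and admissibility. *)
Lemma int_angle_exists : exists a, is_int_angle d (simplex_face S) P a.
Proof.
have S_gt0 : (0 < #|S|)%N by rewrite card_gt0.
pose s : 'rV[R]_d.+1 := \row_j (if j \in S then #|S|%:R^-1 else 0).
have s1 : \sum_j s 0 j = 1.
  under eq_bigr do rewrite mxE; rewrite -big_mkcond /= sumr_const.
  by rewrite -[LHS]mulr_natr mulVf // pnatr_eq0 -lt0n.
pose x := s *m V.
have xb : bary x = s by exact: bary_comb_vertices.
have xS : simplex_face S x.
  apply/(simplex_faceE bary_comb); exists s; split => // j.
    by rewrite mxE; case: ifP.
  by rewrite mxE => /negbTE ->.
(* On a ball of radius [r] every coordinate changes by at most [r * M]; the summand 1 keeps [M]
   positive. *)
pose M := 1 + \sum_i \sum_j `|L i j|.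
have M0 : 0 < M by rewrite ltr_pwDl // sumr_ge0 // => i _; rewrite sumr_ge0.
pose r := (2 * d.+1%:R * M)^-1.
have r0 : 0 < r by rewrite invr_gt0 !mulr_gt0.
have ball_pos y j : eball x r y -> j \in S -> 0 < bary y 0 j.
  move=> yb jS.
  have diff : `|bary y 0 j - bary x 0 j| <= r * M.
    have -> : bary y 0 j - bary x 0 j = ((y - x) *m L) 0 j.
      by rewrite mulmxBl !mxE; ring.
    rewrite mxE mulrDr mulr1 -[leLHS]add0r lerD ?(ltW r0) //.
    apply: le_trans (ler_norm_sum _ _ _) _; rewrite mulr_sumr.
    apply: ler_sum => i _; rewrite normrM ler_pM //.
      exact: (eball_entry _ (ltW r0)).
    by rewrite (bigD1 j) //= lerDl sumr_ge0.
  have rM : r * M = (2 * d.+1%:R)^-1.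
    by rewrite /r; field; rewrite !gt_eqF //= ?mulr_gt0.
  have : d.+1%:R^-1 <= bary x 0 j.
    rewrite xb mxE jS lef_pV2 ?posrE ?ltr0n // ler_nat.
    by have := max_card (mem S); rewrite card_ord.
  move: diff; rewrite rM invfM ler_norml => /andP[h _].
  have : 0 < d.+1%:R^-1 :> R by rewrite invr_gt0.
  by move: h; move: (d.+1%:R^-1) => D; lra.
exists (fine (relvol d P (eball x r `&` P)) / fine (relvol d P (eball x r))).
exists x, r; split => //.
  split=> //; exists r => // y [yb].
  rewrite (aff_hull_face bary_comb) => -[w /= w1 yE].
  pose w' : 'rV[R]_d.+1 := w *m rowsub enum_val 1%:M.
  have yE' : y = w' *m V by rewrite -yE -mulmxA mul_rowsub_mx mul1mx.
  have w'S j : j \notin S -> w' 0 j = 0.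
    move=> jS; rewrite mxE big1 // => i _; rewrite !mxE.
    by case: eqP (enum_valP i) jS => [-> ->//|_ _ _]; rewrite mulr0.
  have w'1 : \sum_j w' 0 j = 1.
    rewrite -w1; under [LHS]eq_bigr do rewrite mxE; rewrite exchange_big /=.
    apply: eq_bigr => i _; rewrite -mulr_sumr (bigD1 (enum_val i)) //=.
    rewrite !mxE eqxx big1 ?addr0 ?mulr1 // => i' ii'.
    by rewrite !mxE eq_sym (negbTE ii').
  have yb' : bary y = w' by rewrite yE'; exact: bary_comb_vertices.
  split; first by exists w'.
    move=> j; have [jS|jS] := boolP (j \in S); first exact/ltW/ball_pos.
    by rewrite yb' w'S.
  by move=> j; rewrite yb'; exact: w'S.
move=> G /(is_faceP bary_comb)[T T0 ->] [y [yb [_ _ yT]]].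
apply: subset_simplex_face; apply/fintype.subsetP => j jS.
by apply/negPn/negP => /yT yj; have := ball_pos y j yb jS; rewrite yj ltxx.
Qed.

Lemma int_angle_face : int_angle d (simplex_face S) P =
  \sum_(T : {set 'I_d.+1} | T \subset S) cell_prob bary_form T.
Proof. by apply: int_angle_value; apply: xgetPex; exact: int_angle_exists. Qed.

End Face.

Lemma alpha_vector_simplex : alpha_vector d P =
  orbit_weights (cell_prob bary_form) *m angle_basis d.
Proof.
apply/rowP => i; rewrite mxE (angle_sum_simplex bary_comb).
rewrite -orbit_weights_basis //.
- apply: eq_bigr => S /eqP Si; apply: int_angle_face.
  by rewrite -card_gt0 Si.
- move=> T; apply: cell_probC.
  exact: bary_form_neq0.
- by apply: cell_prob0; [exact: bary_form_neq0 | exact: sum_bary_form].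
Qed.

Lemma sum_simplex_weights :
  \sum_k (orbit_weights (cell_prob bary_form)) 0 k = 1.
Proof.
apply: sum_orbit_weights => //.
- move=> T; apply: cell_probC; exact: bary_form_neq0.
- by apply: cell_prob0; [exact: bary_form_neq0 | exact: sum_bary_form].
- exact: sum_cell_prob.
Qed.

End InteriorAngles.

(** * Sheared simplices *)

(** [frame] depends only on the affine hull, so all full-dimensional simplices of one space share a
    frame, and its matrix can be fixed before they are built. *)
Lemma frame_full (R : realType) n d (P : set 'rV[R]_n) :
  aff_hull P = setT -> frame d P = frame d setT.
Proof.
move=> PT; rewrite /frame; congr xget; apply/funext => z.
rewrite /is_frame PT (_ : aff_hull setT = setT) //.
apply/seteqP; split => // x _; exists 1%N, (fun=> 1), (fun=> x).
by split; rewrite ?big_ord1 ?scale1r.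
Qed.

(* In the direction of the first coordinate exactly [k] of the barycentric
   coordinates decrease; the other directions are damped by [eta], so that
   almost every direction has a sign pattern with [k] or [d + 2 - k] minus signs. *)
Section ShearedSimplex.
Context {R : realType} {d : nat}.
Variables (eta : R) (k : nat) (B0 : 'M[R]_d.+1).
Hypotheses (eta_gt0 : 0 < eta) (k_gt0 : (0 < k)%N) (k_le : (k <= d.+1)%N).
Hypothesis B0_orth : B0 *m B0^T = 1%:M.

(** The slopes of barycentric coordinates 1 to [d.+1]; coordinate 0 receives minus their sum. The
    entry [- d.+1%:R] outweighs the other [d] entries, so coordinate 0 has slope at least 1. *)
Definition slope (j : 'I_d.+1) : R :=
  if j == ord0 then - d.+1%:R else if (j < k)%N then -1 else 1.

Definition shear_mx : 'M[R]_d.+1 :=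
  \matrix_(i, j) (if i == ord0 then slope j else eta * (i == j)%:R).

Lemma shear_unitmx : shear_mx \in unitmx.
Proof.
rewrite unitmxE -det_tr det_trig.
  rewrite unitfE; apply/prodf_neq0 => i _; rewrite !mxE.
  case: ifP => [/eqP ->|_]; first by rewrite /slope eqxx oppr_eq0 pnatr_eq0.
  by rewrite eqxx mulr1 gt_eqF.
apply/is_trig_mxP => i j ij; rewrite !mxE.
case: eqP ij => [->//|_] ij.
by rewrite -(inj_eq val_inj) /= gtn_eqF // mulr0.
Qed.

Definition sheared_forms : 'M[R]_(d.+1, d.+2) := shear_mx *m diff_mx.

Definition drop_first : 'M[R]_(d.+2, d.+1) := \matrix_(j, i) (j == lift ord0 i)%:R.

(** Vertex 0 is the origin. The factors [invmx shear_mx] and [B0] are chosen so that, in coordinates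
    with basis [B0], the barycentric coordinates have linear parts [sheared_forms]. *)
Definition sheared_vertices : 'M[R]_(d.+2, d.+1) := drop_first *m invmx shear_mx *m B0.

Lemma sheared_bary (s : 'rV[R]_d.+2) : \sum_j s 0 j = 1 ->
  s *m sheared_vertices *m (B0^T *m sheared_forms) + delta_mx 0 ord0 = s.
Proof.
move=> s1; rewrite /sheared_vertices /sheared_forms !mulmxA.
rewrite -(mulmxA _ B0) B0_orth mulmx1 mulmxKV ?shear_unitmx //.
have sE i : (s *m drop_first) 0 i = s 0 (lift ord0 i).
  rewrite mxE (bigD1 (lift ord0 i)) //= mxE eqxx mulr1 big1 ?addr0 // => j ji.
  by rewrite mxE (negbTE ji) mulr0.
apply/rowP => j; rewrite mxE [delta_mx _ _ _ _]mxE eqxx /=.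
have [i ->|->] := unliftP ord0 j; first by rewrite mul_diff_mx sE addr0.
rewrite mul_diff_mx0 eqxx /= -s1 [X in _ + X]big_ord_recl.
by under [X in - X]eq_bigr do rewrite sE; rewrite addrCA addNr addr0.
Qed.

Definition low_vertices : {set 'I_d.+2} := [set j : 'I_d.+2 | (0 < j <= k)%N]%SET.

Lemma card_low_vertices : #|low_vertices| = k.
Proof.
have -> : low_vertices = [set lift ord0 (widen_ord k_le i) | i : 'I_k]%SET.
  apply/setP => j; rewrite inE; apply/idP/imsetP => [/andP[j0 jk]|[i _ ->]].
    have jk' : (j.-1 < k)%N by rewrite prednK.
    by exists (Ordinal jk') => //; apply: val_inj; rewrite /= /bump /= add1n prednK.
  by rewrite /= /bump /= add1n ltn_ord.
rewrite card_imset ?card_ord // => i i' /lift_inj /(congr1 val) /= ii'.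
exact: val_inj.
Qed.

Lemma sheared_form_offdiag i j : i != ord0 -> `|sheared_forms i j| <= eta.
Proof.
move=> i0; rewrite -[sheared_forms i j]/((shear_mx *m diff_mx) i j).
have -> : (shear_mx *m diff_mx) i j = (row i shear_mx *m diff_mx) 0 j.
  by rewrite -row_mul [RHS]mxE.
have [j' ->|->] := unliftP ord0 j.
  rewrite mul_diff_mx !mxE (negbTE i0) normrM gtr0_norm // normr_nat.
  by rewrite ler_piMr ?(ltW eta_gt0) // lern1 leq_b1.
rewrite mul_diff_mx0 normrN (bigD1 i) //= !mxE (negbTE i0) eqxx mulr1.
rewrite big1 ?addr0 ?gtr0_norm // => j' ij'.
by rewrite !mxE (negbTE i0) eq_sym (negbTE ij') mulr0.
Qed.

Lemma sheared_form_first j :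
  if j \in low_vertices then sheared_forms ord0 j <= -1 else 1 <= sheared_forms ord0 j.
Proof.
have E : sheared_forms ord0 j = (row ord0 shear_mx *m diff_mx) 0 j.
  by rewrite -row_mul [RHS]mxE.
have A0 i : row ord0 shear_mx 0 i = slope i by rewrite !mxE eqxx.
rewrite E; have [i ->|->] := unliftP ord0 j.
  rewrite mul_diff_mx A0 /slope inE /= /bump /= add1n.
  case: eqP => [->|_]; first by rewrite /= k_gt0 lerN2 ler1n.
  by case: (i < k)%N; rewrite lexx.
rewrite mul_diff_mx0 inE /= big_ord_recl A0 {1}/slope eqxx opprD opprK.
have : \sum_(i < d) row ord0 shear_mx 0 (lift ord0 i) <= \sum_(i < d) 1.
  apply: ler_sum => i _; rewrite A0 /slope -(inj_eq val_inj) /=.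
  by case: ifP => // _; lra.
by rewrite sumr_const card_ord -natr1; lra.
Qed.

(** The damped directions contribute less than [|tnth t ord0|], while the first term of each form is
    at least that large; so the first term decides every sign. *)
Lemma sheared_neg_set (t : d.+1.-tuple R) :
  cball 1 t -> d.+1%:R * eta < `|tnth t ord0| ->
  neg_set (fun j i => sheared_forms i j) t = low_vertices \/
  neg_set (fun j i => sheared_forms i j) t = (~: low_vertices)%SET.
Proof.
move=> tb te.
pose rest j := \sum_(i < d) tnth t (lift ord0 i) * sheared_forms (lift ord0 i) j.
have lE j : linform (fun i => sheared_forms i j) t =
    tnth t ord0 * sheared_forms ord0 j + rest j.
  by rewrite /linform big_ord_recl.
have rest_le j : `|rest j| < `|tnth t ord0|.
  apply: le_lt_trans te; apply: le_trans (ler_norm_sum _ _ _) _.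
  apply: (@le_trans _ _ (\sum_(i < d) eta)).
    apply: ler_sum => i _; rewrite normrM -[leRHS]mul1r ler_pM //.
      exact: cball_le.
    exact: sheared_form_offdiag.
  by rewrite sumr_const card_ord -[_ *+ d]mulr_natl ler_pM2r // ler_nat.
have [t0|t0] := leP 0 (tnth t ord0); [left|right]; apply/setP => j; rewrite !inE lE.
  have := sheared_form_first j; rewrite inE.
  have := rest_le j; rewrite (ger0_norm t0) ltr_norml => /andP[r1 r2].
  by case: ifP => _ h; [|apply/negbTE; rewrite -leNgt]; nra.
have := sheared_form_first j; rewrite inE.
have := rest_le j; rewrite (ltr0_norm t0) ltr_norml opprK => /andP[r1 r2].
by case: ifP => _ h; [apply/negbTE; rewrite -leNgt|]; nra.
Qed.

End ShearedSimplex.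

(** Outside the slab [|tnth t ord0| <= e] every pattern has the orbit size of [K], and the slab
    fills less than half of the ball. *)
Lemma cell_prob_concentrated (R : realType) d (l : 'I_d.+2 -> 'I_d.+1 -> R)
    (K : {set 'I_d.+2}) (e : R) : 0 <= e ->
  2 ^+ d.+1 * e * 2 < fine (vol d.+1 (@cball R d.+1 1)) ->
  (forall t, cball 1 t -> e < `|tnth t ord0| ->
    neg_set l t = K \/ neg_set l t = (~: K)%SET) ->
  1 < 2 * \sum_(T | orbit_size T == orbit_size K) cell_prob l T.
Proof.
move=> e0 e_small lK; rewrite -cell_prob_sum.
set b := fine (vol d.+1 (cball 1)) in e_small *.
have b0 : 0 < b by exact: vol_cball1_gt0.
set A := _ `&` _; set slab := [set t | (`|tnth t ord0| <= e)%R] `&` @cball R d.+1 1.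
have bfin : vol d.+1 (@cball R d.+1 1) \is a fin_num.
  by apply: sub_cball_fin_num => //; exact: measurable_cball.
have mA : measurable A.
  have -> : A = \bigcup_(T in [set T : {set 'I_d.+2} | orbit_size T == orbit_size K])
      neg_cell l T.
    apply/seteqP; split => [t [/= h tb]|t [T /= h [/= tT tb]]].
      by exists (neg_set l t).
    by split => //=; rewrite tT.
  by apply: fin_bigcup_measurable => // T _; exact: measurable_neg_cell.
have mslab : measurable slab by exact: measurable_slab.
have : (vol d.+1 (@cball R d.+1 1) <= vol d.+1 A + (2 ^+ d.+1 * e)%:E)%E.
  apply: (@le_trans _ _ (vol d.+1 A + vol d.+1 slab)%E); last first.
    by rewrite leeD2l // vol_slab_le.
  apply: le_trans (@measureU2 _ _ _ (vol d.+1) A slab mA mslab).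
  apply: le_measure; rewrite ?inE; [exact: measurable_cball|exact: measurableU|].
  move=> t tb; have [te|te] := leP `|tnth t ord0| e; [by right|left].
  split => //=; have [->//|->] := lK t tb te.
  by rewrite orbit_sizeC.
have Afin : vol d.+1 A \is a fin_num by apply: sub_cball_fin_num => // t [].
rewrite -(fineK bfin) -(fineK Afin) -EFinD lee_fin -/b => bA.
rewrite mulrA ltr_pdivlMr // mul1r; lra.
Qed.

Theorem theorem4p3 (R : realType) (d : nat) (hd : (1 <= d)%N) :
  aff_dim (simplex_alpha_vectors R d) ((d - 1) %/ 2)%N.
Proof.
(* From here on the dimension is [d.+1], so the simplices have [d.+2] vertices. *)
case: d hd => // d _; set m := ((d.+1 - 1) %/ 2)%N.
pose B0 := (frame d.+1 ([set: 'rV[R]_d.+1])).2.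
have B0_orth : B0 *m B0^T = 1%:M.
  have : exists z, is_frame (d := d.+1) ([set: 'rV[R]_d.+1]) z.
    exists (0, 1%:M); split; first by rewrite trmx1 mulmx1.
    apply/seteqP; split => // x _; first by exists x; rewrite //= mulmx1 add0r.
    exists 1%N, (fun=> 1), (fun=> x).
    by split; rewrite ?big_ord1 ?scale1r.
  by move/(xgetPex (0, 0)) => -[].
pose b := fine (vol d.+1 (@cball R d.+1 1)).
have b0 : 0 < b by exact: vol_cball1_gt0.
(* The slab bound [2 ^+ d.+1 * e] becomes a quarter of the volume of the ball, below the half that
   concentration requires. *)
pose e := b / (2 ^+ d.+1 * 4).
have e0 : 0 < e by rewrite divr_gt0 // mulr_gt0 ?exprn_gt0.
(* This ensures [d.+1%:R * eta <= e], as the sign pattern outside the slab requires. *)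
pose eta := e / d.+2%:R.
have eta0 : 0 < eta by rewrite divr_gt0.
pose l (k : nat) (j : 'I_d.+2) (i : 'I_d.+1) := sheared_forms eta k i j.
pose W := \matrix_(k < m.+1) orbit_weights (cell_prob (l k.+1)).
have k_le (k : 'I_m.+1) : (k.+1 <= d.+1)%N.
  by have := ltn_ord k; rewrite /m; lia.
have sheared (k : 'I_m.+1) : \sum_j W k j = 1 /\
    simplex_alpha_vectors R d.+1 (row k W *m angle_basis d.+1).
  pose V := sheared_vertices eta k.+1 B0.
  pose L := B0^T *m sheared_forms eta k.+1.
  have VL : forall s : 'rV_d.+2, \sum_j s 0 j = 1 ->
    s *m V *m L + delta_mx 0 ord0 = s by move=> s; exact: sheared_bary.
  pose P := conv_hull (range (fun j => row j V)).
  have PT : aff_hull P = setT.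
    rewrite (aff_hull_conv_hull VL); have [FF ->] := frame_simplex VL.
    apply/seteqP; split => // x _.
    exists ((x - (frame d.+1 P).1) *m (frame d.+1 P).2^T) => //.
    by rewrite -mulmxA (mulmx1C FF) mulmx1 addrC subrK.
  (* The simplex spans the whole space, so its frame has the matrix [B0], which cancels against
     [B0^T] in [L]. *)
  have lE : bary_form V L = l k.+1.
    apply/funext => j; apply/funext => i.
    by rewrite /bary_form frame_full // mulmxA B0_orth mul1mx.
  have Wk : row k W = orbit_weights (cell_prob (bary_form V L)) by rewrite lE rowK.
  split.
    rewrite -(sum_simplex_weights VL) // -Wk; apply: eq_bigr => j _.
    by rewrite [RHS]mxE.
  exists d.+1, P; split; last by rewrite (alpha_vector_simplex VL) // Wk.
  exists (fun j => row j V) => // w w0 wV j.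
  have /rowP/(_ j) : \row_j w j = 0.
    apply: (vertices_aff_indep VL); first by under eq_bigr do rewrite mxE.
    by rewrite mulmx_sum_row; under eq_bigr do rewrite mxE.
  by rewrite !mxE.
have Wu : W \in unitmx.
  apply: dominant_diag_unitmx => [i j|i|i].
  - by rewrite !mxE sumr_ge0 // => T _; exact: cell_prob_ge0.
  - by have [] := sheared i.
  (* Here [i.+1 <= d.+2 - i.+1], because [2 * i <= d]. *)
  have oi : orbit_size (@low_vertices d i.+1) = i.+1.
    rewrite /orbit_size card_low_vertices //.
    by have := ltn_ord i; rewrite /m; lia.
  rewrite !mxE.
  rewrite (eq_bigl (fun T => orbit_size T == orbit_size (@low_vertices d i.+1))); last first.
    by move=> T; rewrite oi.
  apply: (@cell_prob_concentrated _ _ _ _ e); first exact: ltW.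
    rewrite -/b /e (_ : _ * 2 = b / 2); first by lra.
    by field; rewrite expf_neq0.
  move=> t tb te; apply: sheared_neg_set => //.
  apply: le_lt_trans te; rewrite /eta mulrCA ler_piMr ?(ltW e0) //.
  by rewrite ler_pdivrMr // mul1r ler_nat.
apply: (aff_dim_of_spanning (B := angle_basis d.+1) _ _ Wu).
- exact: row_free_angle_basis.
- move=> a [n [P [[v v_ind ->] ->]]].
  pose V := \matrix_j v j.
  have vV : v = (fun j => row j V) by apply/funext => j; rewrite rowK.
  rewrite vV in v_ind *.
  have [L [c VL]] := row_free_bary v_ind.
  exists (orbit_weights (cell_prob (bary_form V L))).
    exact: (sum_simplex_weights VL).
  by rewrite (alpha_vector_simplex VL).
- by move=> k; have [] := sheared k.
- by move=> k; have [] := sheared k.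
Qed.
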